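(* Let $S_{m,n}$ be sparse sign embeddings with sparsity $\zeta_m$, and let $U_n$ be deterministic $n\times p$ matrices with orthonormal columns, $p$ fixed. If as $m,n\to\infty$, $(\sqrt m/\zeta_m)\,\|\mathrm{vec}(U_n)\|_4^4\to0$ and $\zeta_m^2/m\to0$, then $$\sqrt m\,\mathrm{vec}(U_n^\top S_{m,n}^\top S_{m,n}U_n-I_p)\Rightarrow\mathcal N(0,I_{p^2}+P_p).$$
   Context: Asymptotic regime: $n\to\infty$, $m=m_n\to\infty$, $m<n$. A sparse sign embedding with integer sparsity $1\le\zeta_m\le m$ is the random $m\times n$ matrix $S_{m,n}=(R_{m,1},\dots,R_{m,n})$ whose columns are i.i.d. uniform on $\{f/\sqrt{\zeta_m}:f\in\{-1,0,1\}^m,\ \|f\|^2=\zeta_m\}$ ($\zeta_m=1$ is CountSketch). $\mathrm{vec}$ stacks the columns of a matrix, $\mathrm{vec}(A)_{(ij)}=A_{ij}$; $\|\mathrm{vec}(U_n)\|_4^4=\sum_{i,j}(U_n)_{ij}^4$; $P_p$ is the $p^2\times p^2$ matrix $(P_p)_{(ij),(kl)}=\delta_{il}\delta_{jk}$. *)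

(* Defs.v *)
From HB Require Import structures.
From mathcomp Require Import all_boot all_order all_algebra.
From mathcomp Require Import all_classical all_reals all_analysis.

Set Implicit Arguments.
Unset Strict Implicit.
Unset Printing Implicit Defensive.

Import Order.TTheory GRing.Theory Num.Theory.
Import numFieldNormedType.Exports.

Local Open Scope classical_set_scope.
Local Open Scope ring_scope.

(** * Vectorization *)

(* [mxvec] is row-major, so the transpose makes [vec] stack the columns; the
   coordinate written (ij) on paper is [vec_index i j]. *)
Definition vec (R : realType) (m n : nat) (A : 'M[R]_(m, n)) : 'cV[R]_(n * m) :=
  (mxvec A^T)^T.

Definition vec_index (m n : nat) (i : 'I_m) (j : 'I_n) : 'I_(n * m) :=
  mxvec_index j i.

(* The pair (i, j) such that [a = vec_index i j]. *)
Definition vec_unindex (m n : nat) (a : 'I_(n * m)) : 'I_m * 'I_n :=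
  let ji := enum_val (cast_ord (esym (mxvec_cast n m)) a) in (ji.2, ji.1).

Lemma vecE (R : realType) (m n : nat) (A : 'M[R]_(m, n)) i j :
  vec A (vec_index i j) 0 = A i j.
Proof. by rewrite /vec /vec_index mxE mxvecE mxE. Qed.

Lemma vec_indexK (m n : nat) (i : 'I_m) (j : 'I_n) :
  vec_unindex (vec_index i j) = (i, j).
Proof.
by rewrite /vec_unindex /vec_index /mxvec_index cast_ordK enum_rankK.
Qed.

Definition commutation_mx (R : realType) (p : nat) : 'M[R]_(p * p) :=
  \matrix_(a, b)
    let (i, j) := vec_unindex a in
    let (k, l) := vec_unindex b in
    (i == l)%:R * (j == k)%:R.

Lemma commutation_mxE (R : realType) (p : nat) (i j k l : 'I_p) :
  commutation_mx R p (vec_index i j) (vec_index k l)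
  = (i == l)%:R * (j == k)%:R.
Proof. by rewrite mxE !vec_indexK. Qed.

(** * Random vectors *)

Definition borel (R : realType) (k : nat) : set (set 'cV[R]_k) :=
  <<s [set B : set 'cV[R]_k | open B] >>.

Definition mutually_independent (R : realType) (d : measure_display)
    (T : measurableType d) (P : probability T R) (k n : nat)
    (X : 'I_n -> T -> 'cV[R]_k) : Prop :=
  forall (J : {set 'I_n}) (B : 'I_n -> set 'cV[R]_k),
    (forall j, borel (B j)) ->
    P (\bigcap_(j in [set` J]) X j @^-1` B j)
    = (\prod_(j in J) P (X j @^-1` B j))%E.

Definition uniform_on (R : realType) (d : measure_display)
    (T : measurableType d) (P : probability T R) (k : nat)
    (X : T -> 'cV[R]_k) (F : set 'cV[R]_k) : Prop :=
  exists N : nat, [/\ (0 < N)%N, (F #= `I_N)%card &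
    forall v, F v -> P (X @^-1` [set v]) = (N%:R^-1)%:E].

(** * Sparse sign embeddings *)

Definition sign_columns (R : realType) (m zeta : nat) : set 'cV[R]_m :=
  [set (Num.sqrt zeta%:R)^-1 *: f | f in
    [set f : 'cV[R]_m | (forall i, f i 0 \in [:: -1; 0; 1]) /\
                        \sum_i f i 0 ^+ 2 = zeta%:R]].

(* The first clause says that the entries, hence the whole matrix, are
   measurable functions on the underlying probability space. *)
Definition sparse_sign_embedding (R : realType) (d : measure_display)
    (T : measurableType d) (P : probability T R) (m n zeta : nat)
    (S : T -> 'M[R]_(m, n)) : Prop :=
  [/\ forall i j, measurable_fun [set: T] (fun w => S w i j),
      mutually_independent P (fun j w => col j (S w)) &
      forall j, uniform_on P (fun w => col j (S w)) (@sign_columns R m zeta)].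

(** * Convergence in distribution and multivariate normal laws *)

(* Each [X n] may live on its own probability space. *)
Definition cvg_in_distribution (R : realType) (k : nat)
    (d : nat -> measure_display) (T : forall n, measurableType (d n))
    (P : forall n, probability (T n) R) (X : forall n, T n -> 'cV[R]_k)
    (d' : measure_display) (T' : measurableType d') (Q : probability T' R)
    (Y : T' -> 'cV[R]_k) : Prop :=
  forall f : 'cV[R]_k -> R,
    continuous f -> (exists M : R, forall x, `|f x| <= M) ->
    (\int[P n]_w (f (X n w))%:E)%E @[n --> \oo] --> (\int[Q]_w (f (Y w))%:E)%E.

Section standard_normal_tuple.
Variable R : realType.
Local Open Scope ereal_scope.

Definition cons_pair (k : nat) (xs : measurableTypeR R * k.-tuple (measurableTypeR R)) :
  k.+1.-tuple (measurableTypeR R) := [tuple of xs.1 :: xs.2].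

Lemma measurable_cons_pair k : measurable_fun [set: _] (@cons_pair k).
Proof. exact: measurable_cons. Qed.

HB.instance Definition _ k :=
  isMeasurableFun.Build _ _ _ _ (@cons_pair k) (@measurable_cons_pair k).

(* The law of k independent N(0,1) variables. *)
Fixpoint std_normal (k : nat) : probability (k.-tuple (measurableTypeR R)) R :=
  match k with
  | 0 => \d_ [tuple]
  | k'.+1 =>
      distribution (normal_prob (0 : R) (1 : R) \x std_normal k') (@cons_pair k')
  end.

End standard_normal_tuple.

(* N(mu, Sigma) is the law of mu + A Z, where A A^T = Sigma and Z has i.i.d.
   N(0,1) coordinates; the law depends on A only through A A^T, and Sigma may
   be singular. *)
Definition gaussian_vector (R : realType) (l k : nat) (mu : 'cV[R]_k)
    (A : 'M[R]_(k, l)) (z : l.-tuple (measurableTypeR R)) : 'cV[R]_k :=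
  mu + A *m \col_i tnth z i.

Definition cvg_to_normal (R : realType) (k : nat)
    (d : nat -> measure_display) (T : forall n, measurableType (d n))
    (P : forall n, probability (T n) R) (X : forall n, T n -> 'cV[R]_k)
    (mu : 'cV[R]_k) (Sigma : 'M[R]_k) : Prop :=
  exists (l : nat) (A : 'M[R]_(k, l)),
    A *m A^T = Sigma /\
    cvg_in_distribution P X (std_normal R l) (gaussian_vector mu A).

(* Main.v *)
Require Import Defs.
From HB Require Import structures.
From mathcomp Require Import all_boot all_order all_algebra.
From mathcomp Require Import all_classical all_reals all_analysis.
From mathcomp Require Import perm measurable_realfun ring lra.

Set Implicit Arguments.
Unset Strict Implicit.
Unset Printing Implicit Defensive.

Import Order.TTheory GRing.Theory Num.Theory.
Import numFieldNormedType.Exports.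

Local Open Scope classical_set_scope.
Local Open Scope ring_scope.

(** The columns [R_j] of the sketch are independent unit vectors, so the Gram
    matrix of the sketch has diagonal exactly 1, and a linear functional [t] of
    the rescaled error is an off-diagonal quadratic form
    [sqrt m * \sum_(i < j) b_ij <R_i, R_j>] with
    [b = U (t + t^T) U^T] ([embedding_error_mart]). Revealing the columns one at
    a time makes it a martingale. Given the past, the increment
    [sqrt m * <V_j, R_j>], [V_j = \sum_(i < j) b_ij R_i], has mean 0 and variance
    [|V_j|^2], because the covariance of a column is [1 / m] times the identity.
    Two facts are needed.

    The conditional variance is nearly deterministic: [|V_j|^2] has mean
    [s_j = \sum_(i < j) b_ij^2] and variance at most [4 s_j^2 / m]
    ([avg_normsq_comb_var]).

    The fourth moments are negligible: a Khinchin inequality for the signs of a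
    column ([avg_dot_pow4]) bounds the fourth moment of the increment by a
    multiple of [s_j^2 + (m / zeta^2) \sum_(i < j) b_ij^4]. As [b_ij^2] is at
    most a constant times [|u_i|^2 |u_j|^2], where [u_i] is the i-th row of [U],
    the sum over [j] is at most a constant times [q + (sqrt m * q / zeta)^2]
    with [q = \sum_i |u_i|^4], and this is what the hypotheses send to 0.

    Replacing one increment after the other by a Gaussian factor
    [exp (- s_j / 2)] then gives the characteristic function of the form with an
    explicit error ([char_mart]). The total variance [\sum_j s_j] tends to half
    of the squared Frobenius norm of [t + t^T] ([sum_var_stepE]), which is the
    quadratic form of [1 + P] at [t].

    The law of the sketch is uniform on a finite set, so that all moments are
    averages over finite types ([expectation_sample]). The passage from
    characteristic functions to convergence in distribution ([levy_continuity])
    uses second moments for tightness, and Bernstein polynomials in the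
    functions [sin (x_i / L)], which are trigonometric polynomials, to
    approximate bounded continuous functions on boxes ([trig_approximation]).
    The characteristic function of the normal law comes from the differential
    equation [h'(t) = - t h(t)] ([derive_gauss_char]). *)

(** * Taylor bounds *)

Section taylor_bounds.
Context {R : realType}.

(** Each Taylor bound below is the derivative of the next one, which vanishes
    at 0; this lemma integrates it. *)
Lemma ge0_of_derive_ge0 (f f' : R -> R) :
  (forall x : R, is_derive x 1 f (f' x)) -> (forall x, 0 <= x -> 0 <= f' x) ->
  f 0 = 0 -> forall x, 0 <= x -> 0 <= f x.
Proof.
move=> df f'0 f0 x; rewrite le_eqVlt => /predU1P[<-|x0]; first by rewrite f0.
have cf : {within `[0, x], continuous f}.
  by apply: derivable_within_continuous => y _; exact: ex_derive.
have [c c0x] := MVT x0 (fun y _ => df y) cf.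
rewrite f0 !subr0 => ->; rewrite mulr_ge0// ?f'0// ltW//.
by move: c0x; rewrite in_itv/= => /andP[].
Qed.

Lemma sin_le_id (x : R) : 0 <= x -> sin x <= x.
Proof.
move=> x0; rewrite -subr_ge0; move: x x0.
apply: (@ge0_of_derive_ge0 (fun x => x - sin x) (fun x => 1 - cos x)) => [x _|].
- by rewrite subr_ge0 cos_le1.
- by rewrite sin0 subr0.
Qed.

Lemma cos_ge_quadratic (x : R) : 0 <= x -> 0 <= cos x - 1 + x ^+ 2 / 2.
Proof.
move: x; apply: (@ge0_of_derive_ge0 (fun x => cos x - 1 + x ^+ 2 / 2)
  (fun x => x - sin x)) => [x|x x0|].
- by apply: is_derive_eq; rewrite /GRing.scale/=; field.
- by rewrite subr_ge0 sin_le_id.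
- by rewrite cos0 subrr add0r expr0n mul0r.
Qed.

Lemma sin_ge_cubic (x : R) : 0 <= x -> 0 <= sin x - x + x ^+ 3 / 6.
Proof.
move: x; apply: (@ge0_of_derive_ge0 (fun x => sin x - x + x ^+ 3 / 6)
  (fun x => cos x - 1 + x ^+ 2 / 2)) => [x|x x0|].
- by apply: is_derive_eq; rewrite /GRing.scale/=; field.
- exact: cos_ge_quadratic.
- by rewrite sin0 subrr add0r expr0n mul0r.
Qed.

Lemma cos_le_quartic (x : R) : 0 <= x ->
  0 <= x ^+ 4 / 24 - (cos x - 1 + x ^+ 2 / 2).
Proof.
move: x; apply: (@ge0_of_derive_ge0 (fun x => x ^+ 4 / 24 - (cos x - 1 + x ^+ 2 / 2))
  (fun x => sin x - x + x ^+ 3 / 6)) => [x|x x0|].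
- by apply: is_derive_eq; rewrite /GRing.scale/=; field.
- exact: sin_ge_cubic.
- by rewrite cos0 subrr add0r !expr0n !mul0r subr0.
Qed.

Lemma cos_taylor (x : R) : `|cos x - (1 - x ^+ 2 / 2)| <= x ^+ 4 / 24.
Proof.
rewrite -[cos x]cos_norm -[x ^+ 2]real_normK ?num_real//.
rewrite (_ : x ^+ 4 = `|x| ^+ 4); last first.
  by rewrite (exprM x 2 2) (exprM `|x| 2 2) real_normK ?num_real.
have := cos_ge_quadratic (normr_ge0 x); have := cos_le_quartic (normr_ge0 x).
set y := `|x|; rewrite -subr_ge0 => h1 h2; rewrite ler_norml; apply/andP; split; lra.
Qed.

Lemma sin_taylor (x : R) : `|sin x - x| <= `|x| ^+ 3 / 6.
Proof.
wlog x0 : x / 0 <= x => [h|].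
  have [|x0] := leP 0 x; first exact: h.
  by have := h (- x); rewrite sinN -opprD !normrN; apply; rewrite oppr_ge0 ltW.
rewrite (ger0_norm x0) ler_norml.
have := sin_ge_cubic x0; have := sin_le_id x0.
have : 0 <= x ^+ 3 by rewrite exprn_ge0.
by move=> *; apply/andP; split; lra.
Qed.

Lemma expRN_taylor (u : R) : 0 <= u -> `|expR (- u) - (1 - u)| <= u ^+ 2 / 2.
Proof.
move=> u0; have h1 : 0 <= expR (- u) - (1 - u) by rewrite subr_ge0 expR_ge1Dx.
rewrite ger0_norm// -subr_ge0; move: u u0 {h1}.
apply: (@ge0_of_derive_ge0 (fun u => u ^+ 2 / 2 - (expR (- u) - (1 - u)))
  (fun u => u - 1 + expR (- u))) => [x|x x0|].
- by apply: is_derive_eq; rewrite /GRing.scale/=; field.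
- by have := expR_ge1Dx (- x); lra.
- by rewrite oppr0 expR0 addr0 subrr expr0n mul0r subr0.
Qed.

End taylor_bounds.

(** * Averages over finite types *)

Section average.
Context {R : realType}.

Definition avg (I : finType) (f : I -> R) : R := (\sum_i f i) / #|I|%:R.

Section avg_theory.
Variable I : finType.
Implicit Types f g : I -> R.

Lemma eq_avg f g : f =1 g -> avg f = avg g.
Proof. by move=> fg; congr (_ / _); apply: eq_bigr. Qed.

Lemma avgD f g : avg (fun i => f i + g i) = avg f + avg g.
Proof. by rewrite /avg big_split mulrDl. Qed.

Lemma avgN f : avg (fun i => - f i) = - avg f.
Proof. by rewrite /avg sumrN mulNr. Qed.

Lemma avgB f g : avg (fun i => f i - g i) = avg f - avg g.
Proof. by rewrite avgD avgN. Qed.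

Lemma avgZ (c : R) f : avg (fun i => c * f i) = c * avg f.
Proof. by rewrite /avg -mulr_sumr mulrA. Qed.

Lemma avg_sum (J : finType) (P : pred J) (F : J -> I -> R) :
  avg (fun i => \sum_(j | P j) F j i) = \sum_(j | P j) avg (F j).
Proof. by rewrite /avg exchange_big /= mulr_suml. Qed.

Lemma ler_avg f g : (forall i, f i <= g i) -> avg f <= avg g.
Proof. by move=> fg; rewrite ler_wpM2r ?invr_ge0 ?ler0n// ler_sum. Qed.

Lemma avg_ge0 f : (forall i, 0 <= f i) -> 0 <= avg f.
Proof. by move=> f0; rewrite divr_ge0 ?ler0n// sumr_ge0. Qed.

Lemma normr_avg f : `|avg f| <= avg (fun i => `|f i|).
Proof.
rewrite normrM [X in _ * X]ger0_norm ?invr_ge0 ?ler0n//.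
by rewrite ler_wpM2r ?invr_ge0 ?ler0n// ler_norm_sum.
Qed.

Lemma avg_reindex (h : I -> I) f : bijective h -> avg (f \o h) = avg f.
Proof.
by move=> bh; rewrite /avg [in RHS](reindex h)//; apply: onW_bij.
Qed.

Hypothesis I0 : (0 < #|I|)%N.

Lemma avg_cst (c : R) : avg (fun _ : I => c) = c.
Proof.
rewrite /avg sumr_const -[c *+ _]mulr_natr mulfK//.
by rewrite pnatr_eq0 -lt0n.
Qed.

(** Jensen's inequality, stated so that [K] may vanish. *)
Lemma avg_norm_le f (K : R) : 0 <= K ->
  avg (fun i => f i ^+ 2) <= K ^+ 2 -> avg (fun i => `|f i|) <= K.
Proof.
move=> K0 fK; apply/ler_addgt0Pr => e e0.
have Ke : 0 < K + e by rewrite ltr_wpDl.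
(* the arithmetic-geometric inequality with weight K + e *)
have h i : `|f i| <= (K + e) / 2 + (2 * (K + e))^-1 * f i ^+ 2.
  rewrite -(real_normK (num_real (f i))) -subr_ge0.
  rewrite (_ : _ - _ = (2 * (K + e))^-1 * (`|f i| - (K + e)) ^+ 2).
    by rewrite mulr_ge0 ?sqr_ge0// invr_ge0 mulr_ge0// ltW.
  by field; rewrite gt_eqF.
apply: le_trans (ler_avg h) _; rewrite avgD avg_cst avgZ.
apply: (@le_trans _ _ ((K + e) / 2 + (2 * (K + e))^-1 * (K + e) ^+ 2)).
  rewrite lerD2l; apply: ler_wpM2l; first by rewrite invr_ge0 mulr_ge0 ?(ltW Ke).
  by rewrite (le_trans fK)// lerXn2r ?nnegrE ?lerDl// ltW.
by rewrite le_eqVlt; apply/orP; left; apply/eqP; field; rewrite gt_eqF.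
Qed.

End avg_theory.

Section resampling.
Variables (J I : finType).

Definition resample (s : {ffun J -> I}) (j : J) (x : I) : {ffun J -> I} :=
  [ffun i => if i == j then x else s i].

Lemma resample_at s j x : resample s j x j = x.
Proof. by rewrite ffunE eqxx. Qed.

Lemma resample_neq s j x i : i != j -> resample s j x i = s i.
Proof. by rewrite ffunE => /negbTE->. Qed.

(** Under the uniform law the coordinates are independent: exchanging the
    resampled coordinate with the fresh one permutes the pairs [(s, x)]. *)
Lemma avg_resample (j : J) (f : {ffun J -> I} -> R) : (0 < #|I|)%N ->
  avg f = avg (fun s => avg (fun x => f (resample s j x))).
Proof.
move=> I0; rewrite {1 2}/avg; congr (_ / _).
under [RHS]eq_bigr do rewrite /avg.
rewrite -mulr_suml (pair_bigA _ (fun s x => f (resample s j x)))/=.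
pose h (u : {ffun J -> I} * I) := (resample u.1 j u.2, u.1 j).
have hK : cancel h h.
  move=> [s x]; rewrite /h/= resample_at; congr pair.
  by apply/ffunP => i; rewrite !ffunE; case: eqP => // ->.
rewrite (reindex h); last by apply: onW_bij; exists h.
rewrite (eq_bigr (fun u : {ffun J -> I} * I => f u.1)); last first.
  move=> u _; congr f; apply/ffunP => i.
  by rewrite !ffunE; case: eqP => // ->.
rewrite -(pair_bigA _ (fun (s : {ffun J -> I}) (x : I) => f s))/=.
have -> : \sum_s \sum_(x : I) f s = \sum_s f s * #|I|%:R :> R.
  by apply: eq_bigr => s _; rewrite sumr_const mulr_natr.
by rewrite -mulr_suml mulfK// pnatr_eq0 -lt0n.
Qed.

End resampling.
End average.

Section sums.
Context {R : realType}.

Lemma sum_lt0 (V : nmodType) n (F : 'I_n -> V) : \sum_(i < n | (i < 0)%N) F i = 0.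
Proof. by rewrite big_pred0. Qed.

Lemma sum_ltS (V : nmodType) n (r : 'I_n) (F : 'I_n -> V) :
  \sum_(i < n | (i < r.+1)%N) F i = \sum_(i < n | (i < r)%N) F i + F r.
Proof.
rewrite (bigD1 r) ?ltnSn//= addrC; congr (_ + _); apply: eq_bigl => i.
by rewrite ltnS andbC ltn_neqAle.
Qed.

Lemma sum_lt_full (V : nmodType) n (F : 'I_n -> V) :
  \sum_(i < n | (i < n)%N) F i = \sum_i F i.
Proof. by apply: eq_bigl => i; rewrite ltn_ord. Qed.

(** Cauchy-Schwarz against the constant 1: the difference of the two sides is
    half of the sum of all [(f i - f j)^2]. *)
Lemma sqr_sum_le (I : finType) (f : I -> R) :
  (\sum_i f i) ^+ 2 <= #|I|%:R * \sum_i f i ^+ 2.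
Proof.
have : 0 <= \sum_i \sum_j (f i - f j) ^+ 2.
  by apply: sumr_ge0 => i _; apply: sumr_ge0 => j _; exact: sqr_ge0.
have -> : \sum_i \sum_j (f i - f j) ^+ 2 =
    2 * (#|I|%:R * \sum_i f i ^+ 2 - (\sum_i f i) ^+ 2).
  transitivity (\sum_i \sum_j (f i ^+ 2 + f j ^+ 2 - 2 * (f i * f j))).
    by apply: eq_bigr => i _; apply: eq_bigr => j _; ring.
  transitivity (\sum_i (#|I|%:R * f i ^+ 2 + \sum_j f j ^+ 2
      - 2 * (f i * \sum_j f j))).
    apply: eq_bigr => i _; rewrite sumrB big_split/=.
    by rewrite sumr_const -[f i ^+ 2 *+ _]mulr_natl -!mulr_sumr.
  rewrite sumrB big_split/= sumr_const -!mulr_sumr -mulr_suml.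
  by rewrite -[_ *+ #|_|]mulr_natl; ring.
by rewrite pmulr_rge0 ?subr_ge0.
Qed.

End sums.

(** * Random sign vectors *)

Section sign_vectors.
Context {R : realType}.
Variables m zeta : nat.

Definition support_card (x : {ffun 'I_m -> option bool}) : nat :=
  #|[pred k | x k != None]|.

(** The value 0 is coded by [None] and [(-1)^b] by [Some b], which makes the
    columns of the sketch a finite type. *)
Definition sign_vector := {x : {ffun 'I_m -> option bool} | support_card x == zeta}.
HB.instance Definition _ := Finite.on sign_vector.

Definition sign_value (s : option bool) : R :=
  if s is Some b then (-1) ^+ b else 0.

Definition sign_column (x : sign_vector) : 'cV[R]_m :=
  \col_k (sign_value (sval x k) / Num.sqrt zeta%:R).

Lemma sign_value_sqr s : sign_value s ^+ 2 = (s != None)%:R.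
Proof. by case: s => [b|] /=; rewrite ?sqrr_sign// expr0n. Qed.

Lemma sign_value_cube s : sign_value s ^+ 3 = sign_value s.
Proof. by case: s => [[]|] /=; rewrite ?expr0n// ?expr1n// expr1; ring. Qed.

Lemma sum_sign_value_sqr (x : sign_vector) :
  \sum_k sign_value (sval x k) ^+ 2 = zeta%:R.
Proof.
under eq_bigr do rewrite sign_value_sqr.
rewrite -natr_sum -{2}(eqP (valP x)) /support_card -sum1_card.
congr (_%:R); rewrite [RHS]big_mkcond /=; apply: eq_bigr => k _.
by rewrite inE; case: (sval x k).
Qed.

End sign_vectors.
(** The uniform law on sign vectors is invariant under sign changes and
    transpositions of coordinates. *)
Section permuting.
Variables m zeta : nat.
Local Notation V := (sign_vector m zeta).

Definition flip_fun (k : 'I_m) (x : {ffun 'I_m -> option bool}) :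
  {ffun 'I_m -> option bool} :=
  [ffun l => if l == k then omap negb (x l) else x l].

Lemma flip_subproof k (x : V) : support_card (flip_fun k (sval x)) == zeta.
Proof.
apply/eqP; rewrite -[RHS](eqP (valP x)); apply/eq_card => l; rewrite !inE ffunE.
by case: (l =P k) => // _; case: (sval x l).
Qed.

Definition flip k (x : V) : V := Sub (flip_fun k (sval x)) (flip_subproof k x).

Lemma flipK k : involutive (flip k).
Proof.
move=> x; apply/val_inj/ffunP => l; rewrite !ffunE.
by case: (l =P k) => // _; case: (sval x l) => //= b; rewrite negbK.
Qed.

Definition swap_fun (k l : 'I_m) (x : {ffun 'I_m -> option bool}) :
  {ffun 'I_m -> option bool} := [ffun i => x (tperm k l i)].

Lemma swap_subproof k l (x : V) : support_card (swap_fun k l (sval x)) == zeta.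
Proof.
apply/eqP; rewrite -[RHS](eqP (valP x)) /support_card.
rewrite -(fintype.card_image (@perm_inj _ (tperm k l)) [pred i | sval x i != None]).
apply/eq_card => i; apply/idP/fintype.imageP => [|[j]]; rewrite !inE.
  by rewrite ffunE => h; exists (tperm k l i); rewrite ?inE// tpermK.
by move=> jx ->; rewrite ffunE tpermK.
Qed.

Definition swap k l (x : V) : V := Sub (swap_fun k l (sval x)) (swap_subproof k l x).

Lemma swapK k l : involutive (swap k l).
Proof.
by move=> x; apply/val_inj/ffunP => i; rewrite !ffunE tpermK.
Qed.

End permuting.

Section moments.
Context {R : realType}.
Variables m zeta : nat.
Hypothesis zeta_gt0 : (0 < zeta)%N.
Local Notation V := (sign_vector m zeta).
Hypothesis V_gt0 : (0 < #|{: V}|)%N.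
Local Notation chi x k := (sign_column (R := R) (x : V) k 0).
Implicit Types (x : V) (v : 'cV[R]_m) (k l : 'I_m).

Definition dot (u v : 'cV[R]_m) : R := \sum_k u k 0 * v k 0.

Definition normsq (u : 'cV[R]_m) : R := \sum_k u k 0 ^+ 2.

Definition normp4 (u : 'cV[R]_m) : R := \sum_k u k 0 ^+ 4.

Let zeta_neq0 : zeta%:R != 0 :> R.
Proof. by rewrite pnatr_eq0 -lt0n. Qed.

Let sqrt_zeta : Num.sqrt zeta%:R ^+ 2 = zeta%:R :> R.
Proof. by rewrite sqr_sqrtr ?ler0n. Qed.

Let sqrt_zeta_neq0 : Num.sqrt zeta%:R != 0 :> R.
Proof. by rewrite -sqrf_eq0 sqrt_zeta. Qed.

Lemma chi_flip k x l : chi (flip k x) l = if l == k then - chi x l else chi x l.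
Proof.
rewrite !mxE /= ffunE; case: (l =P k) => // _.
by case: (sval x l) => [[]|]/=; rewrite ?expr0 ?expr1 ?mul0r ?oppr0 ?mulN1r ?opprK ?mul1r ?mulNr.
Qed.

Lemma chi_swap k l x i : chi (swap k l x) i = chi x (tperm k l i).
Proof. by rewrite !mxE /= ffunE. Qed.

Lemma chi_cube x k : chi x k ^+ 3 = chi x k / zeta%:R.
Proof.
rewrite !mxE expr_div_n sign_value_cube -[X in _ = _ / X]sqrt_zeta.
by field.
Qed.

Lemma normsq_chi x : normsq (sign_column x) = 1.
Proof.
rewrite /normsq; under eq_bigr do rewrite mxE expr_div_n sqrt_zeta.
by rewrite -mulr_suml sum_sign_value_sqr divff.
Qed.

Lemma normp4_chi x : normp4 (sign_column x) = zeta%:R^-1.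
Proof.
rewrite /normp4.
under eq_bigr do rewrite exprSr chi_cube mulrAC -expr2.
by rewrite -mulr_suml -/(normsq _) normsq_chi mul1r.
Qed.

Lemma m_gt0 : (0 < m)%N.
Proof.
move/card_gt0P : V_gt0 => [x _]; rewrite lt0n; apply/eqP => m0.
have := normsq_chi x; rewrite /normsq big1 => [/esym/eqP|[k km]].
  by rewrite oner_eq0.
by exfalso; rewrite m0 in km.
Qed.

Let m_neq0 : m%:R != 0 :> R.
Proof. by rewrite pnatr_eq0 -lt0n m_gt0. Qed.

Lemma zeta_le_m : (zeta <= m)%N.
Proof.
move/card_gt0P : V_gt0 => [x _].
by rewrite -(eqP (valP x)) -[leqRHS]card_ord max_card.
Qed.

Definition flip_invariant (g : V -> R) := forall k x, g (flip k x) = g x.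

Lemma avg_flip k (f : V -> R) : avg (fun x => f (flip k x)) = avg f.
Proof. by rewrite -(avg_reindex f (inv_bij (@flipK _ _ k))). Qed.

Lemma avg_swap k l (f : V -> R) : avg (fun x => f (swap k l x)) = avg f.
Proof. by rewrite -(avg_reindex f (inv_bij (@swapK _ _ k l))). Qed.

(** Sign symmetry: what changes sign with one coordinate averages to 0. *)
Lemma avg_odd k (f : V -> R) : (forall x, f (flip k x) = - f x) -> avg f = 0.
Proof.
move=> fN; have := avg_flip k f; rewrite (eq_avg fN) avgN => /eqP.
by rewrite eq_sym -addr_eq0 -mulr2n mulrn_eq0/= => /eqP.
Qed.

Lemma avg_chi k : avg (fun x => chi x k) = 0.
Proof. by apply: (@avg_odd k) => x; rewrite chi_flip eqxx. Qed.

Lemma avg_chi_sqr k : avg (fun x => chi x k ^+ 2) = m%:R^-1.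
Proof.
have e l : avg (fun x => chi x l ^+ 2) = avg (fun x => chi x k ^+ 2).
  rewrite -(avg_swap k l); apply: eq_avg => x.
  by rewrite chi_swap tpermR.
have : avg (fun x => normsq (sign_column (R := R) x)) = 1.
  by rewrite (eq_avg normsq_chi) avg_cst.
rewrite avg_sum (eq_bigr _ (fun l _ => e l)) sumr_const card_ord => h.
by apply: (mulfI m_neq0); rewrite mulr_natl h divff.
Qed.

Lemma avg_chi_pow4 k : avg (fun x => chi x k ^+ 4) = (m%:R * zeta%:R)^-1.
Proof.
rewrite (@eq_avg _ _ _ (fun x => zeta%:R^-1 * chi x k ^+ 2)).
  by rewrite avgZ avg_chi_sqr invfM mulrC.
by move=> x; rewrite exprSr chi_cube mulrAC -expr2 mulrC.
Qed.

(** Conditioning on [x_k != 0] removes one of the [zeta] nonzero coordinates,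
    so the squares of distinct coordinates are negatively correlated. *)
Lemma avg_chi_sqr2 k l : k != l ->
  avg (fun x => chi x k ^+ 2 * chi x l ^+ 2) <= (m%:R ^+ 2)^-1.
Proof.
move=> kl; set q := avg _.
have e i : i != k -> avg (fun x => chi x k ^+ 2 * chi x i ^+ 2) = q.
  move=> ik; rewrite -(avg_swap l i); apply: eq_avg => x.
  by rewrite !chi_swap tpermR tpermD// eq_sym.
have : avg (fun x => \sum_i chi x k ^+ 2 * chi x i ^+ 2) = m%:R^-1.
  rewrite -(avg_chi_sqr k); apply: eq_avg => x.
  by rewrite -mulr_sumr -/(normsq _) normsq_chi mulr1.
rewrite avg_sum (bigD1 k)//= (eq_bigr _ (fun i ik => e i ik)) sumr_const.
rewrite (_ : avg _ = (m%:R * zeta%:R)^-1); last first.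
  by rewrite -(avg_chi_pow4 k); apply: eq_avg => x; rewrite -exprD.
rewrite cardC1 card_ord => h.
have m1 : (0 < m.-1)%N.
  rewrite -subn1 subn_gt0 -[m]card_ord; apply/card_gt1P.
  by exists k, l.
have mE : m%:R = m.-1%:R + 1 :> R by rewrite natr1 prednK// m_gt0.
rewrite -(ler_pM2l (_ : 0 < m.-1%:R)) ?ltr0n// mulr_natl.
have -> : q *+ m.-1 = m%:R^-1 - (m%:R * zeta%:R)^-1 by rewrite -h addrAC subrr add0r.
have -> : m.-1%:R * (m%:R ^+ 2)^-1 = m%:R^-1 - (m%:R * m%:R)^-1 :> R.
  by apply/eqP; rewrite -subr_eq0 mE; apply/eqP; field; rewrite -mE.
rewrite lerB// lef_pV2 ?posrE ?mulr_gt0 ?ltr0n ?m_gt0//.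
by rewrite ler_pM2l ?ltr0n ?m_gt0// ler_nat zeta_le_m.
Qed.

End moments.

Section linear_forms.
Context {R : realType}.
Variables m zeta : nat.
Hypothesis zeta_gt0 : (0 < zeta)%N.
Local Notation V := (sign_vector m zeta).
Hypothesis V_gt0 : (0 < #|{: V}|)%N.
Local Notation chi x := (sign_column (R := R) (x : V)).
Implicit Types (x : V) (v : 'cV[R]_m).

Let partial_form r v x := \sum_(k < m | (k < r)%N) v k 0 * chi x k 0.

Let partial_sq r v x := \sum_(k < m | (k < r)%N) (v k 0 * chi x k 0) ^+ 2.

Let partial_form_flip (r : 'I_m) v x :
  partial_form r v (flip r x) = partial_form r v x.
Proof.
apply: eq_bigr => k kr; rewrite chi_flip; case: eqP => // E.
by rewrite E ltnn in kr.
Qed.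

(** The weight g is even in each coordinate, hence the cross term is odd in the
   coordinate that is added. *)
Let avg_partial_form_sqr (g : V -> R) v r : (r <= m)%N -> flip_invariant g ->
  avg (fun x => g x * partial_form r v x ^+ 2) =
  avg (fun x => g x * partial_sq r v x).
Proof.
move=> + gF; elim: r => [_|r IH rm].
  by apply: eq_avg => x; rewrite /partial_form /partial_sq !sum_lt0 expr0n.
pose r' := Ordinal rm; pose c x := v r' 0 * chi x r' 0.
transitivity (avg (fun x => g x * partial_form r v x ^+ 2) +
    2 * avg (fun x => g x * partial_form r v x * c x) +
    avg (fun x => g x * c x ^+ 2)).
  rewrite -avgZ -!avgD; apply: eq_avg => x.
  by rewrite /partial_form (sum_ltS r') -/(c x); ring.
rewrite IH ?(ltnW rm)// (@avg_odd _ _ _ r' (fun x => _ * c x)).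
  rewrite mulr0 addr0 -avgD; apply: eq_avg => x.
  by rewrite /partial_sq (sum_ltS r') -/(c x) mulrDr.
by move=> x; rewrite gF (partial_form_flip r') /c chi_flip eqxx; ring.
Qed.

(** Only even powers of the new term c survive; the mixed term c^2 Z^2 is an
   instance of the previous identity with weight c^2, and the constant 3 absorbs
   6 c^2 Q as the double product of (Q + c^2)^2. *)
Let avg_partial_form_pow4 v r : (r <= m)%N ->
  avg (fun x => partial_form r v x ^+ 4) <=
  3 * avg (fun x => partial_sq r v x ^+ 2).
Proof.
elim: r => [_|r IH rm].
  rewrite le_eqVlt; apply/orP; left; apply/eqP; rewrite -avgZ; apply: eq_avg => x.
  by rewrite /partial_form /partial_sq !sum_lt0 !expr0n/= mulr0.
pose r' := Ordinal rm; pose c x := v r' 0 * chi x r' 0.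
have cF : flip_invariant (fun x => c x ^+ 2).
  by move=> k x; rewrite /c chi_flip; case: eqP => // _; rewrite mulrN sqrrN.
have -> : avg (fun x => partial_form r.+1 v x ^+ 4) =
    avg (fun x => partial_form r v x ^+ 4) +
    6 * avg (fun x => c x ^+ 2 * partial_form r v x ^+ 2) +
    avg (fun x => c x ^+ 4) +
    4 * avg (fun x => (partial_form r v x ^+ 3 + partial_form r v x * c x ^+ 2) * c x).
  rewrite -!avgZ -!avgD; apply: eq_avg => x.
  by rewrite /partial_form (sum_ltS r') -/(c x); ring.
rewrite (avg_partial_form_sqr _ (ltnW rm) cF).
rewrite (@avg_odd _ _ _ r' (fun x => _ * c x)); last first.
  move=> x; rewrite (partial_form_flip r') /c chi_flip eqxx; ring.
rewrite mulr0 addr0.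
apply: (@le_trans _ _ (3 * avg (fun x => partial_sq r v x ^+ 2) +
   6 * avg (fun x => c x ^+ 2 * partial_sq r v x) + 3 * avg (fun x => c x ^+ 4))).
  apply: lerD; first by rewrite lerD2r IH// ltnW.
  rewrite ler_peMl ?ler1n//; apply: avg_ge0 => x.
  by rewrite exprn_even_ge0.
rewrite -!avgZ -!avgD; apply: ler_avg => x.
rewrite /partial_sq (sum_ltS r') -/(c x).
by rewrite le_eqVlt; apply/orP; left; apply/eqP; ring.
Qed.

Lemma avg_dot v : avg (fun x => dot v (chi x)) = 0.
Proof.
rewrite avg_sum big1// => k _.
by rewrite avgZ avg_chi mulr0.
Qed.

Lemma avg_dot_sqr v : avg (fun x => dot v (chi x) ^+ 2) = normsq v / m%:R.
Proof.
have := @avg_partial_form_sqr (fun=> 1) v m (leqnn m) (fun _ _ => erefl).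
rewrite (@eq_avg _ _ _ (fun x => dot v (chi x) ^+ 2)); last first.
  by move=> x; rewrite mul1r /partial_form sum_lt_full.
move=> ->; rewrite (@eq_avg _ _ _ (fun x => \sum_k v k 0 ^+ 2 * chi x k 0 ^+ 2)).
  rewrite avg_sum /normsq mulr_suml; apply: eq_bigr => k _.
  by rewrite avgZ avg_chi_sqr.
move=> x; rewrite mul1r /partial_sq sum_lt_full; apply: eq_bigr => k _.
by rewrite exprMn.
Qed.

(** Khinchin's inequality for the random signs, followed by the correlation
    bounds for the random support. *)
Lemma avg_dot_pow4 v : avg (fun x => dot v (chi x) ^+ 4) <=
  3 * (normp4 v / (m%:R * zeta%:R) + normsq v ^+ 2 / m%:R ^+ 2).
Proof.
have := @avg_partial_form_pow4 v m (leqnn m).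
rewrite (@eq_avg _ _ _ (fun x => dot v (chi x) ^+ 4)); last first.
  by move=> x; rewrite /partial_form sum_lt_full.
move=> /le_trans; apply; rewrite ler_pM2l//.
rewrite (@eq_avg _ _ _ (fun x => \sum_k \sum_l
    (v k 0 ^+ 2 * v l 0 ^+ 2) * (chi x k 0 ^+ 2 * chi x l 0 ^+ 2))); last first.
  move=> x; rewrite /partial_sq sum_lt_full expr2 mulr_suml.
  apply: eq_bigr => k _; rewrite mulr_sumr; apply: eq_bigr => l _.
  by rewrite !exprMn; ring.
rewrite avg_sum /normp4 [normsq v ^+ 2]expr2 /normsq 3!mulr_suml -big_split/=.
apply: ler_sum => k _; rewrite avg_sum (bigD1 k)//=; apply: lerD.
  rewrite avgZ -exprD (@eq_avg _ _ _ (fun x => chi x k 0 ^+ 4)).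
    by rewrite avg_chi_pow4.
  by move=> x; rewrite -exprD.
rewrite mulrAC mulr_sumr [leRHS](bigD1 k)//= ler_wpDl//.
  by rewrite mulr_ge0 ?sqr_ge0// mulr_ge0 ?sqr_ge0// invr_ge0 sqr_ge0.
apply: ler_sum => l lk; rewrite avgZ mulrAC; apply: ler_wpM2l.
  by apply: mulr_ge0; exact: sqr_ge0.
by apply: avg_chi_sqr2 => //; rewrite eq_sym.
Qed.

End linear_forms.

(** * Weighted sums of independent columns *)

Section columns.
Context {R : realType}.
Variables m zeta n : nat.
Hypothesis zeta_gt0 : (0 < zeta)%N.
Local Notation V := (sign_vector m zeta).
Hypothesis V_gt0 : (0 < #|{: V}|)%N.
Local Notation chi x := (sign_column (R := R) (x : V)).
Local Notation sample := {ffun 'I_n -> V}.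
Implicit Types (x : V) (b : 'I_n -> R) (s : sample) (r : 'I_n).

Let m_neq0 : m%:R != 0 :> R.
Proof. by rewrite pnatr_eq0 -lt0n (@m_gt0 R _ _ zeta_gt0 V_gt0). Qed.

Let m_gt0 : 0 < m%:R :> R.
Proof. by rewrite lt0r m_neq0 ler0n. Qed.

Lemma sample_gt0 : (0 < #|{: sample}|)%N.
Proof. by rewrite card_ffun expn_gt0 V_gt0. Qed.

Definition comb b (r : nat) s : 'cV[R]_m := \sum_(i < n | (i < r)%N) b i *: chi (s i).

Definition weight b (r : nat) : R := \sum_(i < n | (i < r)%N) b i ^+ 2.

Definition weight4 b (r : nat) : R := \sum_(i < n | (i < r)%N) b i ^+ 4.

Lemma weight_ge0 b r : 0 <= weight b r.
Proof. by apply: sumr_ge0 => i _; exact: sqr_ge0. Qed.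

Lemma comb_resample_ge b (r' : nat) r s x : (r' <= r)%N ->
  comb b r' (resample s r x) = comb b r' s.
Proof.
move=> rr; apply: eq_bigr => i ir; rewrite resample_neq//.
by apply: contraTneq (leq_trans ir rr) => ->; rewrite ltnn.
Qed.

Lemma combS_resample b r s x :
  comb b r.+1 (resample s r x) = comb b r s + b r *: chi x.
Proof. by rewrite {1}/comb sum_ltS -/(comb b r _) comb_resample_ge// resample_at. Qed.

(** Integrating out the last column gives a recursion in [r] for all moments of
    [comb b r]. *)
Lemma avg_combS b r (f : 'cV[R]_m -> R) :
  avg (fun s => f (comb b r.+1 s)) =
  avg (fun s => avg (fun x => f (comb b r s + b r *: chi x))).
Proof.
rewrite (avg_resample r)//; apply: eq_avg => s; apply: eq_avg => x.
by rewrite combS_resample.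
Qed.

Lemma avg_comb0 b (f : 'cV[R]_m -> R) : avg (fun s => f (comb b 0 s)) = f 0.
Proof.
rewrite (@eq_avg _ _ _ (fun=> f 0)) ?avg_cst ?sample_gt0// => s.
by rewrite /comb sum_lt0.
Qed.

Lemma normsqD (u v : 'cV[R]_m) (c : R) :
  normsq (u + c *: v) = normsq u + 2 * c * dot u v + c ^+ 2 * normsq v.
Proof.
rewrite /normsq /dot !mulr_sumr -!big_split/=; apply: eq_bigr => k _.
by rewrite !mxE; ring.
Qed.

Lemma normsq0 : normsq (0 : 'cV[R]_m) = 0.
Proof. by rewrite /normsq big1// => k _; rewrite mxE expr0n. Qed.

Lemma avg_normsqD (u : 'cV[R]_m) (c : R) :
  avg (fun x => normsq (u + c *: chi x)) = normsq u + c ^+ 2.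
Proof.
under eq_avg do rewrite normsqD normsq_chi// mulr1.
by rewrite !avgD !avg_cst// avgZ avg_dot// mulr0 addr0.
Qed.

Lemma avg_normp4D (u : 'cV[R]_m) (c : R) :
  avg (fun x => normp4 (u + c *: chi x)) =
  normp4 u + 6 * c ^+ 2 * normsq u / m%:R + c ^+ 4 / zeta%:R.
Proof.
rewrite (@eq_avg _ _ _ (fun x => normp4 u +
    \sum_k ((4 * c * u k 0 ^+ 3 + 4 * c ^+ 3 * u k 0 / zeta%:R) * chi x k 0
      + (6 * c ^+ 2 * u k 0 ^+ 2) * chi x k 0 ^+ 2) + c ^+ 4 / zeta%:R)).
  rewrite !avgD !avg_cst// avg_sum; congr (_ + _ + _).
  rewrite /normsq mulr_sumr mulr_suml; apply: eq_bigr => k _.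
  by rewrite avgD !avgZ avg_chi avg_chi_sqr// mulr0 add0r.
move=> x; rewrite -[X in _ + c ^+ 4 * X](normp4_chi (R := R) zeta_gt0 x) /normp4 mulr_sumr -!big_split/=.
apply: eq_bigr => k _; rewrite !mxE.
set a := u k 0; set y := _ / Num.sqrt _.
have y3 : y ^+ 3 = y / zeta%:R by have := chi_cube (R := R) zeta_gt0 x k; rewrite !mxE.
have -> : (4 * c * a ^+ 3 + 4 * c ^+ 3 * a / zeta%:R) * y =
   4 * c * a ^+ 3 * y + 4 * c ^+ 3 * a * (y / zeta%:R) by ring.
by rewrite -y3; ring.
Qed.

Lemma avg_normsq_comb b (r : nat) : (r <= n)%N ->
  avg (fun s => normsq (comb b r s)) = weight b r.
Proof.
elim: r => [_|r IH rn].
  by rewrite (avg_comb0 b (@normsq _ _)) normsq0 /weight sum_lt0.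
rewrite (avg_combS b (Ordinal rn) (@normsq _ _)).
under eq_avg do rewrite avg_normsqD.
rewrite avgD avg_cst ?sample_gt0// IH ?(ltnW rn)//.
by rewrite /weight (sum_ltS (Ordinal rn)).
Qed.

(** The squared norm minus its mean is a martingale with increments
    [2 c <V, R>], whose conditional variance is [4 c^2 |V|^2 / m]. *)
Lemma avg_normsq_comb_var b (r : nat) : (r <= n)%N ->
  avg (fun s => (normsq (comb b r s) - weight b r) ^+ 2) <=
  4 * weight b r ^+ 2 / m%:R.
Proof.
elim: r => [_|r IH rn].
  rewrite (avg_comb0 b (fun v => (normsq v - _) ^+ 2)) normsq0 /weight sum_lt0.
  by rewrite subr0 expr0n/= mulr0 mul0r.
pose r' := Ordinal rn; pose c := b r'.
rewrite (avg_combS b r' (fun v => (normsq v - _) ^+ 2)).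
have -> : weight b r.+1 = weight b r + c ^+ 2 by rewrite /weight (sum_ltS r').
rewrite (@eq_avg _ _ _ (fun s => (normsq (comb b r s) - weight b r) ^+ 2 +
    4 * c ^+ 2 / m%:R * normsq (comb b r s))); last first.
  move=> s; set v := comb b r s; set w := weight b r.
  rewrite (@eq_avg _ _ _ (fun x => (normsq v - w) ^+ 2 +
      (4 * c * (normsq v - w)) * dot v (chi x) + 4 * c ^+ 2 * dot v (chi x) ^+ 2)).
    rewrite !avgD avg_cst// !avgZ avg_dot// avg_dot_sqr// mulr0 addr0.
    by congr (_ + _); ring.
  by move=> x; rewrite normsqD normsq_chi// -/c; ring.
rewrite avgD avgZ avg_normsq_comb ?(ltnW rn)//.
have := IH (ltnW rn); set w := weight b r => h.
apply: (le_trans (lerD h (lexx _))).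
have w0 : 0 <= w := weight_ge0 b (Ordinal rn).
rewrite -subr_ge0.
have -> : 4 * (w + c ^+ 2) ^+ 2 / m%:R -
  (4 * w ^+ 2 / m%:R + 4 * c ^+ 2 / m%:R * w) = (4 * w * c ^+ 2 + 4 * c ^+ 4) / m%:R.
  by field.
rewrite divr_ge0 ?ler0n//; apply: addr_ge0; apply: mulr_ge0;
  by rewrite ?exprn_even_ge0 ?mulr_ge0 ?ler0n.
Qed.

Lemma avg_normsq_comb_sqr b (r : nat) : (r <= n)%N ->
  avg (fun s => normsq (comb b r s) ^+ 2) <= 5 * weight b r ^+ 2.
Proof.
move=> rn; have := avg_normsq_comb_var b rn; set w := weight b r => h.
rewrite (@eq_avg _ _ _ (fun s => (normsq (comb b r s) - w) ^+ 2 +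
  2 * w * normsq (comb b r s) - w ^+ 2)); last by move=> s; ring.
rewrite avgB avgD avg_cst ?sample_gt0// avgZ avg_normsq_comb// -/w.
have : 4 * w ^+ 2 / m%:R <= 4 * w ^+ 2.
  rewrite ler_pdivrMr//; apply: ler_peMr; last by rewrite ler1n -(ltr0n R).
  by rewrite mulr_ge0 ?ler0n// sqr_ge0.
by move: h; lra.
Qed.

(** A column has fourth-power norm [1 / zeta]: this is where the sparsity
    enters the Lyapunov condition. *)
Lemma avg_normp4_comb b (r : nat) : (r <= n)%N ->
  avg (fun s => normp4 (comb b r s)) <=
  6 * weight b r ^+ 2 / m%:R + weight4 b r / zeta%:R.
Proof.
elim: r => [_|r IH rn].
  rewrite (avg_comb0 b (@normp4 _ _)) /normp4 big1 => [|k _]; last first.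
    by rewrite mxE expr0n.
  by rewrite /weight /weight4 !sum_lt0 expr0n/= mulr0 !mul0r addr0.
pose r' := Ordinal rn; pose c := b r'.
rewrite (avg_combS b r' (@normp4 _ _)).
under eq_avg do rewrite avg_normp4D.
rewrite !avgD avg_cst ?sample_gt0// -/c.
rewrite (@eq_avg _ _ (fun i => _ / m%:R)
  (fun s => 6 * c ^+ 2 / m%:R * normsq (comb b r s))); last by move=> s; ring.
rewrite avgZ avg_normsq_comb ?(ltnW rn)//.
rewrite /weight4 (sum_ltS r') -/(weight4 b r) -/c.
have -> : weight b r.+1 = weight b r + c ^+ 2 by rewrite /weight (sum_ltS r').
have := IH (ltnW rn); set w := weight b r => h.
have w0 : 0 <= w := weight_ge0 b (Ordinal rn).
rewrite [(_ + _) / zeta%:R]mulrDl addrA lerD2r; apply: (le_trans (lerD h (lexx _))).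
rewrite -subr_ge0; have -> : forall q : R, 6 * (w + c ^+ 2) ^+ 2 / m%:R + q -
  (6 * w ^+ 2 / m%:R + q + 6 * c ^+ 2 / m%:R * w) =
  (6 * w * c ^+ 2 + 6 * c ^+ 4) / m%:R by move=> q; field.
rewrite divr_ge0 ?ler0n//; apply: addr_ge0; apply: mulr_ge0;
  by rewrite ?exprn_even_ge0 ?mulr_ge0 ?ler0n.
Qed.

End columns.

(** * Martingale central limit theorem *)

Section char_step.
Context {R : realType}.

Lemma cube_le_sqr_pow4 (D e : R) : 0 < e -> `|D| ^+ 3 <= (e * D ^+ 2 + e^-1 * D ^+ 4) / 2.
Proof.
move=> e0; rewrite -[D ^+ 2]real_normK ?num_real//.
have -> : D ^+ 4 = `|D| ^+ 4.
  by rewrite (exprM D 2 2) (exprM `|D| 2 2) real_normK ?num_real.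
set y := `|D|; rewrite -subr_ge0.
have -> : (e * y ^+ 2 + e^-1 * y ^+ 4) / 2 - y ^+ 3 =
  e^-1 / 2 * (y * (e - y)) ^+ 2 by field; rewrite gt_eqF.
by rewrite mulr_ge0 ?sqr_ge0// divr_ge0// invr_ge0 ltW.
Qed.

(** The free parameter [e] trades the third moment for the second and the
    fourth. *)
Lemma cosD_taylor (theta D e : R) : 0 < e ->
  `|cos (theta + D) - (cos theta * (1 - D ^+ 2 / 2) - sin theta * D)| <=
  e * D ^+ 2 + (1 + e^-1) * D ^+ 4.
Proof.
move=> e0; rewrite cosD.
have -> : cos theta * cos D - sin theta * sin D -
    (cos theta * (1 - D ^+ 2 / 2) - sin theta * D) =
  cos theta * (cos D - (1 - D ^+ 2 / 2)) - sin theta * (sin D - D) by ring.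
apply: (le_trans (ler_normB _ _)); rewrite !normrM.
have h1 : `|cos theta| * `|cos D - (1 - D ^+ 2 / 2)| <= D ^+ 4 / 24.
  by rewrite -[leRHS]mul1r ler_pM// ?cos_max// cos_taylor.
have h2 : `|sin theta| * `|sin D - D| <= `|D| ^+ 3 / 6.
  by rewrite -[leRHS]mul1r ler_pM// ?sin_max// sin_taylor.
have h3 := cube_le_sqr_pow4 D e0.
have h4 : 0 <= e * D ^+ 2 by rewrite mulr_ge0 ?sqr_ge0// ltW.
have h5 : 0 <= D ^+ 4 by rewrite exprn_even_ge0.
have h6 : 0 <= e^-1 * D ^+ 4 by rewrite mulr_ge0// invr_ge0 ltW.
apply: (le_trans (lerD h1 h2)); lra.
Qed.

Lemma expR_gauss_approx (v s : R) : 0 <= s ->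
  `|1 - v / 2 - expR (- (s / 2))| <= `|v - s| + s ^+ 2.
Proof.
move=> s0; have := expRN_taylor (divr_ge0 s0 (ler0n R 2)).
have -> : 1 - v / 2 - expR (- (s / 2)) =
   - (v - s) / 2 - (expR (- (s / 2)) - (1 - s / 2)) by field.
move=> h; apply: (le_trans (ler_normB _ _)).
rewrite normrM normrN [X in _ * X]ger0_norm ?invr_ge0//.
apply: lerD; first by rewrite ler_piMr// invf_le1// ler1n.
apply: (le_trans h); have := sqr_ge0 s; rewrite expr_div_n; lra.
Qed.

Variables m zeta n : nat.
Hypothesis zeta_gt0 : (0 < zeta)%N.
Local Notation V := (sign_vector m zeta).
Hypothesis V_gt0 : (0 < #|{: V}|)%N.
Local Notation chi x := (sign_column (R := R) (x : V)).
Local Notation sample := {ffun 'I_n -> V}.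
Local Notation sqrtm := (Num.sqrt m%:R : R).

Let m_gt0 : 0 < m%:R :> R.
Proof. by rewrite ltr0n (@m_gt0 R _ _ zeta_gt0 V_gt0). Qed.

Let m_neq0 : m%:R != 0 :> R.
Proof. by rewrite gt_eqF. Qed.

Let zeta_neq0 : zeta%:R != 0 :> R.
Proof. by rewrite pnatr_eq0 -lt0n. Qed.

Let sqrtm_gt0 : 0 < sqrtm.
Proof. by rewrite sqrtr_gt0. Qed.

Let sqrtm_sqr : sqrtm ^+ 2 = m%:R.
Proof. by rewrite sqr_sqrtr// ltW. Qed.

Let sqrtm_pow4 : sqrtm ^+ 4 = m%:R ^+ 2.
Proof. by rewrite (exprM _ 2 2) sqrtm_sqr. Qed.

(** One column integrated out: [theta] is the contribution of the previous
    columns and [v] their weighted sum. *)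
Lemma avg_cos_column (theta s e : R) (v : 'cV[R]_m) : 0 < e -> 0 <= s ->
  `|avg (fun x => cos (theta + sqrtm * dot v (chi x))) - expR (- (s / 2)) * cos theta| <=
  `|normsq v - s| + s ^+ 2 + e * normsq v +
  (1 + e^-1) * (3 * (m%:R / zeta%:R * normp4 v + normsq v ^+ 2)).
Proof.
move=> e0 s0; pose D x := sqrtm * dot v (chi x).
have D2 : avg (fun x => D x ^+ 2) = normsq v.
  under eq_avg do rewrite exprMn.
  by rewrite avgZ avg_dot_sqr// sqrtm_sqr mulrC divfK.
have D4 : avg (fun x => D x ^+ 4) <= 3 * (m%:R / zeta%:R * normp4 v + normsq v ^+ 2).
  under eq_avg do rewrite exprMn.
  rewrite avgZ sqrtm_pow4.
  apply: (@le_trans _ _ (m%:R ^+ 2 * (3 * (normp4 v / (m%:R * zeta%:R) + normsq v ^+ 2 / m%:R ^+ 2)))).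
    by rewrite ler_wpM2l ?sqr_ge0// avg_dot_pow4.
  rewrite le_eqVlt; apply/orP; left; apply/eqP; field.
  by rewrite zeta_neq0 m_neq0.
have mid : avg (fun x => cos theta * (1 - D x ^+ 2 / 2) - sin theta * D x) =
    cos theta * (1 - normsq v / 2).
  rewrite avgB !avgZ avg_dot// !mulr0 subr0 avgB avg_cst//.
  by under [avg (fun x => _ / _)]eq_avg do rewrite mulrC; rewrite avgZ D2 [_^-1 * _]mulrC.
have h1 : `|avg (fun x => cos (theta + D x)) - cos theta * (1 - normsq v / 2)| <=
    e * normsq v + (1 + e^-1) * (3 * (m%:R / zeta%:R * normp4 v + normsq v ^+ 2)).
  rewrite -mid -avgB; apply: (le_trans (normr_avg _)).
  apply: (le_trans (ler_avg (fun x => cosD_taylor theta (D x) e0))).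
  by rewrite avgD !avgZ D2 lerD2l ler_wpM2l// addr_ge0// invr_ge0 ltW.
have h2 : `|cos theta * (1 - normsq v / 2) - expR (- (s / 2)) * cos theta| <=
    `|normsq v - s| + s ^+ 2.
  rewrite [expR _ * _]mulrC -mulrBr normrM -[leRHS]mul1r.
  by rewrite ler_pM// ?cos_max// expR_gauss_approx.
have -> : avg (fun x => cos (theta + D x)) - expR (- (s / 2)) * cos theta =
  (cos theta * (1 - normsq v / 2) - expR (- (s / 2)) * cos theta) +
  (avg (fun x => cos (theta + D x)) - cos theta * (1 - normsq v / 2)) by ring.
by apply: (le_trans (ler_normD _ _)); rewrite -addrA lerD.
Qed.

Variable B : 'I_n -> 'I_n -> R.

(** The off-diagonal quadratic form [sqrt m * \sum_(i < j) B i j <R_i, R_j>],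
    restricted to the first [r] columns: a martingale in [r]. *)
Definition mart (r : nat) (s : sample) : R :=
  sqrtm * \sum_(j < n | (j < r)%N) dot (comb (B^~ j) j s) (chi (s j)).

Definition var_step (j : 'I_n) : R := weight (B^~ j) j.

Lemma var_step_ge0 j : 0 <= var_step j. Proof. exact: weight_ge0. Qed.

Lemma martS_resample (r : 'I_n) s x : mart r.+1 (resample s r x) =
  mart r s + sqrtm * dot (comb (B^~ r) r s) (chi x).
Proof.
rewrite /mart sum_ltS -mulrDr resample_at comb_resample_ge//; congr (_ * (_ + _)).
apply: eq_bigr => j jr; rewrite comb_resample_ge ?(ltnW jr)// resample_neq//.
by apply: contraTneq jr => ->; rewrite ltnn.
Qed.

Lemma avg_mart_sqr (r : nat) : (r <= n)%N ->
  avg (fun s => mart r s ^+ 2) = \sum_(j < n | (j < r)%N) var_step j.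
Proof.
elim: r => [_|r IH rn].
  rewrite sum_lt0 (@eq_avg _ _ _ (fun=> 0)) ?avg_cst ?sample_gt0// => s.
  by rewrite /mart sum_lt0 mulr0 expr0n.
pose r' := Ordinal rn.
rewrite (avg_resample r')// (sum_ltS r') -(IH (ltnW rn)) [var_step r']/var_step.
rewrite -(avg_normsq_comb zeta_gt0 V_gt0 (B^~ r') (ltnW rn)) -avgD; apply: eq_avg => s.
set v := comb _ _ _.
rewrite (@eq_avg _ _ _ (fun x => mart r s ^+ 2 +
    (2 * mart r s * sqrtm) * dot v (chi x) + m%:R * dot v (chi x) ^+ 2)).
  by rewrite !avgD avg_cst// !avgZ avg_dot// avg_dot_sqr// mulr0 addr0 [m%:R * _]mulrC divfK.
by move=> x; rewrite (martS_resample r') -/v -[X in _ + X * dot v _ ^+ 2]sqrtm_sqr; ring.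
Qed.

Definition step_error (e : R) (j : 'I_n) : R :=
  2 * var_step j / sqrtm + var_step j ^+ 2 + e * var_step j +
  (1 + e^-1) * (33 * var_step j ^+ 2 + 3 * (m%:R / zeta%:R ^+ 2) * weight4 (B^~ j) j).

(** The error of one replacement, averaged over the past. *)
Lemma avg_column_error (e : R) (j : 'I_n) : 0 < e ->
  avg (fun s : sample => let v := comb (B^~ j) j s in
  `|normsq v - var_step j| + var_step j ^+ 2 + e * normsq v +
  (1 + e^-1) * (3 * (m%:R / zeta%:R * normp4 v + normsq v ^+ 2))) <= step_error e j.
Proof.
move=> e0; have jn := ltnW (ltn_ord j).
have S0 := sample_gt0 n V_gt0.
rewrite /step_error /= !avgD !avgZ avgD avgZ avg_cst// avg_normsq_comb//.
rewrite -/(var_step j); set w := var_step j; have w0 : 0 <= w := var_step_ge0 j.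
apply: lerD.
  rewrite !lerD2r; apply: avg_norm_le => //.
    by rewrite divr_ge0 ?(ltW sqrtm_gt0)// mulr_ge0.
  apply: (le_trans (avg_normsq_comb_var zeta_gt0 V_gt0 (B^~ j) jn)).
  by rewrite expr_div_n sqrtm_sqr exprMn -natrX.
rewrite ler_wpM2l ?addr_ge0 ?invr_ge0 ?(ltW e0)//.
have h4 := avg_normp4_comb zeta_gt0 V_gt0 (B^~ j) jn.
have h2 := avg_normsq_comb_sqr zeta_gt0 V_gt0 (B^~ j) jn.
rewrite -/(var_step j) -/w in h4 h2.
have mz : 0 <= m%:R / zeta%:R :> R by rewrite divr_ge0 ?ler0n.
have := ler_wpM2l mz h4.
have -> : m%:R / zeta%:R * (6 * w ^+ 2 / m%:R + weight4 (B^~ j) j / zeta%:R) =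
  6 * w ^+ 2 / zeta%:R + m%:R / zeta%:R ^+ 2 * weight4 (B^~ j) j.
  by field; rewrite zeta_neq0 m_neq0.
have : 6 * w ^+ 2 / zeta%:R <= 6 * w ^+ 2.
  by rewrite ler_piMr ?mulr_ge0 ?sqr_ge0// invf_le1 ?ler1n ?ltr0n.
lra.
Qed.

(** A central limit theorem with explicit error: conditionally on the first
    [r] columns the next increment contributes a factor
    [exp (- var_step r / 2)] to the characteristic function. *)
Lemma char_mart (theta e : R) (r : nat) : 0 < e -> (r <= n)%N ->
  `|avg (fun s => cos (theta + mart r s)) -
    expR (- ((\sum_(j < n | (j < r)%N) var_step j) / 2)) * cos theta| <=
  \sum_(j < n | (j < r)%N) step_error e j.
Proof.
move=> e0; elim: r => [_|r IH rn].
  rewrite !sum_lt0 mul0r oppr0 expR0 mul1r (@eq_avg _ _ _ (fun=> cos theta)).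
    by rewrite avg_cst ?sample_gt0// subrr normr0.
  by move=> s; rewrite /mart sum_lt0 mulr0 addr0.
pose r' := Ordinal rn; rewrite !(sum_ltS r').
set S := \sum_(j < n | _) var_step j; pose E := expR (- (var_step r' / 2)).
have E0 : 0 <= E <= 1.
  by rewrite expR_ge0 -expR0 ler_expR oppr_le0 divr_ge0 ?var_step_ge0.
rewrite mulrDl opprD expRD -/E.
have -> : avg (fun s => cos (theta + mart r.+1 s)) - expR (- (S / 2)) * E * cos theta =
  (avg (fun s => cos (theta + mart r.+1 s)) - E * avg (fun s => cos (theta + mart r s)))
  + E * (avg (fun s => cos (theta + mart r s)) - expR (- (S / 2)) * cos theta) by ring.
apply: (le_trans (ler_normD _ _)); rewrite addrC lerD//.
  rewrite normrM ger0_norm; last by case/andP: E0.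
  rewrite -[leRHS]mul1r ler_pM ?IH ?(ltnW rn)//; by case/andP: E0.
rewrite (avg_resample r')// -avgZ -avgB.
apply: (le_trans (normr_avg _)).
apply: le_trans (avg_column_error r' e0); apply: ler_avg => s /=.
under eq_avg do rewrite (martS_resample r') addrA.
by apply: avg_cos_column => //; exact: var_step_ge0.
Qed.

End char_step.

(** * Characteristic function of the normal law *)

Section gaussian_characteristic_function.
Context {R : realType}.
Local Notation mu := (@lebesgue_measure R).

Definition gauss_density (x : R) : R := normal_peak 1 * expR (- (x ^+ 2 / 2)).

Lemma gauss_densityE : normal_pdf (0 : R) 1 = gauss_density.
Proof.
rewrite normal_pdfE ?oner_neq0//; apply/funext => x.
by rewrite /= /gauss_density /normal_fun subr0 expr1n mulNr.
Qed.

Lemma gauss_density_ge0 x : 0 <= gauss_density x.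
Proof. by rewrite mulr_ge0 ?expR_ge0 ?normal_peak_ge0. Qed.

Lemma integrable_gauss_density : mu.-integrable setT (EFin \o gauss_density).
Proof. by rewrite -gauss_densityE; exact: integrable_normal_pdf. Qed.

Lemma derive_gauss_density (x : R) : is_derive x 1 gauss_density (- x * gauss_density x).
Proof. by apply: is_derive_eq; rewrite /gauss_density /GRing.scale/=; field. Qed.

Lemma continuous_gauss_density : continuous gauss_density.
Proof.
move=> x; apply: differentiable_continuous; apply/derivable1_diffP.
by have [] := derive_gauss_density x.
Qed.

Lemma continuous_integrable (f h : R -> R) : continuous f ->
  (forall x, `|f x| <= h x) -> mu.-integrable setT (EFin \o h) ->
  mu.-integrable setT (EFin \o f).
Proof.
move=> cf fh ih; apply: (le_integrable measurableT _ _ ih).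
  by apply/measurable_EFinP; exact: continuous_measurable_fun.
by move=> x _; rewrite /= lee_fin (le_trans (fh x))// ler_norm.
Qed.

(** The first moment of the standard density is dominated by a multiple of the
   density of variance 2, since |x| <= exp (x^2 / 4). *)
Lemma integrable_gauss_moment : mu.-integrable setT (fun x => (`|x| * gauss_density x)%:E).
Proof.
pose s : R := Num.sqrt 2.
have s0 : s != 0 by rewrite gt_eqF// sqrtr_gt0.
pose C : R := normal_peak 1 / normal_peak s.
apply: (@continuous_integrable _ (fun x => C * normal_pdf 0 s x)).
- move=> x; apply: continuousM; last exact: continuous_gauss_density.
  exact: norm_continuous.
- move=> x; rewrite normrM normr_id (ger0_norm (gauss_density_ge0 x)).
  rewrite normal_pdfE//= [C * _]mulrA divfK; last by rewrite gt_eqF// normal_peak_gt0.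
  rewrite /gauss_density mulrCA; apply: ler_wpM2l; first exact: normal_peak_ge0.
  rewrite /normal_fun subr0 sqr_sqrtr//.
  have -> : - x ^+ 2 / (2 *+ 2) = x ^+ 2 / 4 - x ^+ 2 / 2 :> R by field.
  rewrite expRD ler_wpM2r ?expR_ge0//.
  apply: le_trans (expR_ge1Dx _).
  rewrite -[x ^+ 2]real_normK ?num_real//; have := sqr_ge0 (`|x| - 2).
  by set y := `|x|; rewrite expr2 [y ^+ 2]expr2; lra.
- under [EFin \o _]eq_fun do rewrite /= EFinM.
  by apply: integrableZl => //; exact: integrable_normal_pdf.
Qed.

(** The fundamental theorem of calculus on the real line. *)
Lemma integral_derivative0 (F f : R -> R) : continuous f ->
  (forall x : R, is_derive x 1 F (f x)) ->
  mu.-integrable setT (EFin \o f) ->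
  F n%:R @[n --> \oo] --> 0 -> F (- n%:R) @[n --> \oo] --> 0 ->
  \int[mu]_x f x = 0.
Proof.
move=> cf dF fi F0 F0N.
pose fn (n : nat) x := f x * \1_(`[- n%:R, n%:R] : set R) x.
have mf : measurable_fun setT f by exact: continuous_measurable_fun.
have h1 : (fun n => \int[mu]_x (fn n x)%:E)%E @ \oo --> (\int[mu]_x (f x)%:E)%E.
  have [] := @dominated_convergence _ _ _ mu setT measurableT
    (fun n x => (fn n x)%:E) (EFin \o f) (fun x => `|f x|%:E).
  - move=> n; apply/measurable_EFinP; apply: measurable_funM => //.
  - exact/measurable_EFinP.
  - apply: aeW => x _; apply: cvg_EFin; first exact: nearW.
    apply: cvg_near_cst; near=> n; rewrite /= /fn indicE mem_set ?mulr1//=.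
    rewrite in_itv/= -ler_norml; near: n; exact: nbhs_infty_ger.
  - by have := integrable_abse fi.
  - apply: aeW => x n _; rewrite lee_fin /fn normrM indicE ler_piMr//.
    by case: (_ \in _); rewrite ?normr1 ?normr0.
  by [].
have h2 n : (\int[mu]_x (fn n.+1 x)%:E = (F n.+1%:R)%:E - (F (- n.+1%:R))%:E)%E.
  rewrite -(@continuous_FTC2 _ f F).
  - rewrite [RHS]integral_mkcond; apply: eq_integral => x _.
    by rewrite /fn patchE indicE; case: (_ \in _); rewrite ?mulr1 ?mulr0.
  - by rewrite (@lt_trans _ _ 0)// ?oppr_lt0 ltr0n.
  - exact: continuous_subspaceT.
  - have cF : continuous F.
      by move=> x; apply/differentiable_continuous/derivable1_diffP; have [] := dF x.
    split; [by move=> x _; have [] := dF x|exact/cvg_at_right_filter/cF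
           |exact/cvg_at_left_filter/cF].
  - by move=> x _; rewrite derive1E; have [] := dF x.
have h3 : (fun n => \int[mu]_x (fn n x)%:E)%E @ \oo --> 0%E.
  rewrite -cvg_shiftS/=; under eq_fun do rewrite h2 -EFinB.
  apply: cvg_EFin; first exact: nearW.
  rewrite -(subr0 0); apply: (@cvgB _ _ _ _ _ (fun n => F n.+1%:R) (fun n => F (- n.+1%:R))).
    by rewrite (cvg_shiftS (fun n => F n%:R)).
  by rewrite (cvg_shiftS (fun n => F (- n%:R))).
rewrite /Rintegral (_ : (\int[mu]_x (f x)%:E = 0)%E)//.
exact: cvg_unique h1 h3.
Unshelve. all: by end_near. Qed.

End gaussian_characteristic_function.

Section gaussian_ode.
Context {R : realType}.
Local Notation mu := (@lebesgue_measure R).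
Local Notation g := (@gauss_density R).

Lemma gauss_density_cvg0 :
  g n%:R @[n --> \oo] --> 0 /\ g (- n%:R) @[n --> \oo] --> 0.
Proof.
have h : g n%:R @[n --> \oo] --> 0.
  rewrite -(mulr0 (normal_peak 1)); apply: cvgM; first exact: cvg_cst.
  have lim0 : (fun n : nat => 2 * n.+1%:R^-1) @ \oo --> (0 : R).
    rewrite -(mulr0 2); apply: cvgM; first exact: cvg_cst.
    exact: cvg_harmonic.
  rewrite -cvg_shiftS/=.
  apply: (squeeze_cvgr _ (cvg_cst 0) lim0); apply: nearW => n.
  rewrite expR_ge0/= expRN -[leRHS]invrK lef_pV2 ?posrE ?expR_gt0 ?invr_gt0 ?mulr_gt0 ?invr_gt0//.
  rewrite invfM invrK; apply: le_trans (expR_ge1Dx _).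
  apply: (@le_trans _ _ (n.+1%:R ^+ 2 / 2)); last by rewrite lerDr.
  by rewrite mulrC ler_pM2r ?invr_gt0// expr2 ler_peMr// ler1n.
split; first exact: h.
have <- : (fun n : nat => g n%:R) = (fun n => g (- n%:R)); last exact: h.
by apply/funext => n; rewrite /gauss_density sqrrN.
Qed.

Lemma integrable_gauss_bounded (f : R -> R) : continuous f ->
  (forall x, `|f x| <= 1) -> mu.-integrable setT (fun x => (f x * g x)%:E).
Proof.
move=> cf f1; apply: (@continuous_integrable _ _ g).
- by move=> x; apply: continuousM; [exact: cf|exact: continuous_gauss_density].
- move=> x; rewrite normrM (ger0_norm (gauss_density_ge0 x)) ler_piMl//.
  exact: gauss_density_ge0.
- exact: integrable_gauss_density.
Qed.

Lemma integrable_gauss_moment_bounded (f : R -> R) : continuous f ->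
  (forall x, `|f x| <= 1) -> mu.-integrable setT (fun x => (x * f x * g x)%:E).
Proof.
move=> cf f1; apply: (@continuous_integrable _ _ (fun x => `|x| * g x)).
- move=> x; apply: cvgM; last exact: continuous_gauss_density.
  by apply: cvgM; [exact: cvg_id|exact: cf].
- move=> x; rewrite normrM (ger0_norm (gauss_density_ge0 x)) normrM.
  by rewrite ler_wpM2r ?gauss_density_ge0// ler_piMr.
- exact: integrable_gauss_moment.
Qed.

Lemma continuous_affine (theta t : R) : continuous (fun x => theta + t * x).
Proof.
move=> x; apply: cvgD; first exact: cvg_cst.
by apply: cvgM; [exact: cvg_cst|exact: cvg_id].
Qed.

Lemma continuous_cos_affine (theta t : R) : continuous (fun x => cos (theta + t * x)).
Proof.
by move=> x; apply: continuous_comp; [exact: continuous_affine|exact: continuous_cos].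
Qed.

Lemma continuous_sin_affine (theta t : R) : continuous (fun x => sin (theta + t * x)).
Proof.
by move=> x; apply: continuous_comp; [exact: continuous_affine|exact: continuous_sin].
Qed.

(** Integration by parts against the Gaussian density, whose logarithmic
    derivative is [- x]. *)
Lemma gauss_stein (theta t : R) :
  \int[mu]_x (x * sin (theta + t * x) * g x) =
  t * \int[mu]_x (cos (theta + t * x) * g x).
Proof.
have i1 := integrable_gauss_bounded (@continuous_cos_affine theta t)
  (fun x => cos_max _).
have i2 := integrable_gauss_moment_bounded (@continuous_sin_affine theta t)
  (fun x => sin_max _).
apply/eqP; rewrite eq_sym -subr_eq0 -RintegralZl// -RintegralB//; last first.
  exact: (integrableZl measurableT t i1).
apply/eqP.
apply: (@integral_derivative0 _ (fun x => sin (theta + t * x) * g x)).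
- move=> x; apply: cvgB.
    apply: cvgM; first exact: cvg_cst.
    apply: cvgM; first exact: continuous_cos_affine.
    exact: continuous_gauss_density.
  apply: cvgM; last exact: continuous_gauss_density.
  by apply: cvgM; [exact: cvg_id|exact: continuous_sin_affine].
- move=> x; have := derive_gauss_density x => dg.
  by apply: is_derive_eq; rewrite /GRing.scale/=; ring.
- rewrite (_ : EFin \o _ = (fun x => (t * (cos (theta + t * x) * g x))%:E
    - (x * sin (theta + t * x) * g x)%:E)%E); last by apply/funext => x /=; rewrite EFinB.
  by apply: integrableB => //; exact: (integrableZl measurableT t i1).
- apply: norm_cvg0.
  apply: (squeeze_cvgr _ (cvg_cst 0) (proj1 gauss_density_cvg0)).
  apply: nearW => n; rewrite normr_ge0/= normrM (ger0_norm (gauss_density_ge0 _)).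
  by rewrite ler_piMl ?gauss_density_ge0// sin_max.
- apply: norm_cvg0.
  apply: (squeeze_cvgr _ (cvg_cst 0) (proj2 gauss_density_cvg0)).
  apply: nearW => n; rewrite normr_ge0/= normrM (ger0_norm (gauss_density_ge0 _)).
  by rewrite ler_piMl ?gauss_density_ge0// sin_max.
Qed.

(** The phase [theta] covers sines and cosines at once, and later absorbs the
    remaining coordinates of a Gaussian vector. *)
Definition gauss_char (theta t : R) : R := \int[mu]_x (cos (theta + t * x) * g x).

(** Differentiation under the integral sign, followed by the integration by
    parts, gives a linear differential equation. *)
Lemma derive_gauss_char (theta t : R) :
  is_derive t 1 (gauss_char theta) (- t * gauss_char theta t).
Proof.
pose f (s x : R) : R := cos (theta + s * x) * g x.
have d1f (s x : R) : is_derive s 1 (f^~ x) (- (x * sin (theta + s * x) * g x)).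
  by apply: is_derive_eq; rewrite /GRing.scale/=; ring.
have d1fE s x : partial1of2 f s x = - (x * sin (theta + s * x) * g x).
  by rewrite partial1of2E; have [] := d1f s x.
have tI : `]t - 1, t + 1[%classic t.
  by rewrite /= in_itv/= ltrBlDr ltrDl ltr01.
have Hi s : `]t - 1, t + 1[%classic s -> mu.-integrable setT (EFin \o f s).
  move=> _; apply: integrable_gauss_bounded; first exact: continuous_cos_affine.
  by move=> x; exact: cos_max.
have Hd s x : `]t - 1, t + 1[%classic s -> setT x -> derivable (f^~ x) s 1.
  by move=> _ _; have [] := d1f s x.
have HG0 x : 0 <= `|x| * g x by rewrite mulr_ge0 ?gauss_density_ge0.
have Hub s x : `]t - 1, t + 1[%classic s -> setT x ->
    `|partial1of2 f s x| <= `|x| * g x.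
  move=> _ _; rewrite d1fE normrN normrM (ger0_norm (gauss_density_ge0 _)) normrM.
  by rewrite ler_wpM2r ?gauss_density_ge0// ler_piMr// sin_max.
have D := derivable_under_integral measurableT tI Hi Hd HG0 integrable_gauss_moment Hub.
have E := differentiation_under_integral measurableT tI Hi Hd HG0 integrable_gauss_moment Hub.
apply: DeriveDef; first exact: D.
rewrite -derive1E [LHS]E /gauss_char mulNr -gauss_stein.
transitivity (\int[mu]_x (- 1 * (x * sin (theta + t * x) * g x))).
  by apply: eq_Rintegral => x _; rewrite d1fE mulN1r.
rewrite RintegralZl ?mulN1r//.
apply: integrable_gauss_moment_bounded; first exact: continuous_sin_affine.
by move=> x; exact: sin_max.
Qed.

Lemma gauss_charE (theta t : R) : gauss_char theta t = expR (- (t ^+ 2 / 2)) * cos theta.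
Proof.
pose k (s : R) := gauss_char theta s * expR (s ^+ 2 / 2).
have dk (s : R) : is_derive s 1 k 0.
  have := derive_gauss_char theta s => dg.
  by apply: is_derive_eq; rewrite /GRing.scale/=; field.
have := is_derive_0_is_cst t 0 dk.
rewrite /k expr0n/= mul0r expR0 mulr1 => h.
rewrite expRN mulrC -[LHS](mulfK (_ : expR (t ^+ 2 / 2) != 0)) ?gt_eqF ?expR_gt0//.
rewrite h; congr (_ / _); rewrite /gauss_char.
transitivity (\int[mu]_x (cos theta * g x)).
  by apply: eq_Rintegral => x _; rewrite mul0r addr0.
rewrite RintegralZl//; last exact: integrable_gauss_density.
by rewrite /Rintegral -gauss_densityE integral_normal_pdf mulr1.
Qed.

End gaussian_ode.

Section bounded_integrals.
Context {R : realType} d (T : measurableType d) (P : probability T R).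

Lemma bounded_integrable (f : T -> R) (M : R) : measurable_fun setT f ->
  (forall x, `|f x| <= M) -> P.-integrable setT (EFin \o f).
Proof.
move=> mf fM; apply: measurable_bounded_integrable => //.
  by rewrite (le_lt_trans (probability_le1 _ _))// ltry.
exists M; split; first exact: num_real.
by move=> x Mx y _ /=; rewrite (le_trans (fM y))// ltW.
Qed.

End bounded_integrals.

Section standard_normal.
Context {R : realType}.
Local Notation mu := (@lebesgue_measure R).
Local Notation N01 := (normal_prob (0 : R) 1).

(** The density is a version of the Radon-Nikodym derivative. *)
Lemma integral_normal_prob (f : R -> R) (M : R) : measurable_fun setT f ->
  (forall x, `|f x| <= M) ->
  (\int[N01]_x (f x)%:E = \int[mu]_x (f x * gauss_density x)%:E)%E.
Proof.
move=> mf fM.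
have dom := @normal_prob_dominates R 0 1.
have fi : N01.-integrable setT (EFin \o f).
  exact: (bounded_integrable (normal_prob 0 1) mf fM).
rewrite -(Radon_Nikodym_change_of_variables dom)//=.
apply: ae_eq_integral => //.
- by apply: emeasurable_funM => //; exact/measurable_EFinP.
- apply/measurable_EFinP; apply: measurable_funM => //.
  by apply: continuous_measurable_fun; exact: continuous_gauss_density.
- under [X in ae_eq _ _ _ X]eq_fun do rewrite EFinM.
  apply: ae_eqe_mul2l => /=.
  rewrite Radon_NikodymE//=.
  case: cid => /= h [h1 h2 h3].
  apply: integral_ae_eq => //=.
  + apply/measurable_EFinP.
    by apply: continuous_measurable_fun; exact: continuous_gauss_density.
  + by move=> E _ mE; rewrite -h3//= /normal_prob gauss_densityE.
Qed.

Lemma normal_char (theta t : R) :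
  (\int[N01]_x (cos (theta + t * x))%:E = (expR (- (t ^+ 2 / 2)) * cos theta)%:E)%E.
Proof.
rewrite (@integral_normal_prob _ 1) => [|/=|x]; last exact: cos_max.
  rewrite -gauss_charE /gauss_char /Rintegral fineK//.
  apply: integrable_fin_num => //; apply: integrable_gauss_bounded.
    exact: continuous_cos_affine.
  by move=> x; exact: cos_max.
by apply: continuous_measurable_fun; exact: continuous_cos_affine.
Qed.

Lemma measurable_cos_linear (l : nat) (a : 'I_l -> R) (theta : R) d (T : measurableType d)
  (X : 'I_l -> T -> R) : (forall i, measurable_fun setT (X i)) ->
  measurable_fun setT (fun z => cos (theta + \sum_i a i * X i z)).
Proof.
move=> mX; apply: measurableT_comp.
  exact: continuous_measurable_fun (@continuous_cos R).
apply: measurable_funD => //; apply: measurable_sum => i.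
exact: measurable_funM.
Qed.

(** By Fubini the first coordinate contributes its factor with the other
    coordinates as a phase. *)
Lemma std_normal_char (l : nat) (a : 'I_l -> R) (theta : R) :
  (\int[std_normal R l]_z (cos (theta + \sum_i a i * tnth z i))%:E =
   (expR (- ((\sum_i a i ^+ 2) / 2)) * cos theta)%:E)%E.
Proof.
elim: l a theta => [|l IH] a theta.
  rewrite !big_ord0 mul0r oppr0 expR0 mul1r /= integral_dirac//.
    by rewrite diracT mul1e big_ord0 addr0.
  apply/measurable_EFinP.
  by apply: measurable_cos_linear => i; exact: measurable_tnth.
pose h (u : measurableTypeR R * l.-tuple (measurableTypeR R)) : R :=
  cos (theta + \sum_(i < l) a (lift ord0 i) * tnth u.2 i + a ord0 * u.1).
have mh : measurable_fun setT h.
  apply: measurableT_comp; first exact: continuous_measurable_fun (@continuous_cos R).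
  apply: measurable_funD; last by apply: measurable_funM.
  apply: measurable_funD => //; apply: measurable_sum => i.
  apply: measurable_funM => //.
  exact: (measurableT_comp (measurable_tnth i)).
have ih : (N01 \x std_normal R l)%E.-integrable setT (EFin \o h).
  by apply: (bounded_integrable _ mh) => u; exact: cos_max.
have hE : (EFin \o h) = (fun z => (cos (theta + \sum_i a i * tnth z i))%:E) \o @cons_pair R l.
  apply/funext => u /=; congr (cos _)%:E.
  rewrite big_ord_recl tnth0 -addrA [_ + a _ * _]addrC; congr (_ + (_ + _)).
  by apply: eq_bigr => i _; rewrite tnthS.
rewrite /= integral_distribution//; last 2 first.
- apply/measurable_EFinP.
  by apply: measurable_cos_linear => i; exact: measurable_tnth.
- by rewrite -hE.
rewrite -hE -integral21_prod_meas1//.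
have inner z : (fubini_G N01 (EFin \o h) z = (expR (- (a ord0 ^+ 2 / 2)))%:E *
    (cos (theta + \sum_(i < l) a (lift ord0 i) * tnth z i))%:E)%E.
  by rewrite -EFinM -normal_char /fubini_G.
rewrite (eq_integral _ _ (fun z _ => inner z)).
rewrite integralZl//; last first.
  apply: (bounded_integrable _ _ (fun z => cos_max _)).
  by apply: measurable_cos_linear => i; exact: measurable_tnth.
rewrite IH -EFinM mulrA -expRD big_ord_recl; congr (expR _ * _)%:E.
by rewrite mulrDl opprD.
Qed.

End standard_normal.

(** * Approximation by trigonometric polynomials *)

Section trigonometric_polynomials.
Context {R : realType}.
Variable k : nat.

Inductive trigpoly : ('cV[R]_k -> R) -> Prop :=
| trigpoly_cos theta t : trigpoly (fun x => cos (theta + dot t x))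
| trigpoly_lin a b f g : trigpoly f -> trigpoly g ->
    trigpoly (fun x => a * f x + b * g x).

Lemma dotDl (s t x : 'cV[R]_k) : dot (s + t) x = dot s x + dot t x.
Proof. by rewrite /dot -big_split; apply: eq_bigr => i _; rewrite mxE mulrDl. Qed.

Lemma dotNl (s x : 'cV[R]_k) : dot (- s) x = - dot s x.
Proof. by rewrite /dot -sumrN; apply: eq_bigr => i _; rewrite mxE mulNr. Qed.

Lemma dot_delta (c : R) (i : 'I_k) x : dot (c *: delta_mx i 0) x = c * x i 0.
Proof.
rewrite /dot (bigD1 i)//= big1 => [|j ji]; rewrite !mxE.
  by rewrite !eqxx mulr1 addr0.
by rewrite (negbTE ji) mulr0 mul0r.
Qed.

Lemma trigpoly_cst (c : R) : trigpoly (fun=> c).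
Proof.
rewrite (_ : (fun=> c) = (fun x : 'cV[R]_k => c * cos (0 + dot 0 x) + 0 * cos (0 + dot 0 x))).
  by apply: trigpoly_lin; exact: trigpoly_cos.
apply/funext => x; rewrite mul0r /dot big1 ?addr0 ?cos0 ?mulr1// => i _.
by rewrite mxE mul0r.
Qed.

(** The product of two cosines is a half-sum of cosines. *)
Lemma trigpolyM f g : trigpoly f -> trigpoly g -> trigpoly (fun x => f x * g x).
Proof.
move=> tf tg; elim: tf => [theta t|a b f1 f2 _ IH1 _ IH2].
  elim: tg => [eta s|a b g1 g2 _ IH1 _ IH2].
    rewrite (_ : (fun _ => _) = (fun x => 2^-1 * cos ((theta + eta) + dot (t + s) x)
        + 2^-1 * cos ((theta - eta) + dot (t - s) x))).
      by apply: trigpoly_lin; exact: trigpoly_cos.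
    apply/funext => x; rewrite !dotDl dotNl.
    have -> : theta + eta + (dot t x + dot s x) = (theta + dot t x) + (eta + dot s x) by ring.
    have -> : theta - eta + (dot t x - dot s x) = (theta + dot t x) - (eta + dot s x) by ring.
    by set p := theta + _; set q := eta + _; rewrite cosD cosB; field.
  rewrite (_ : (fun _ => _) = (fun x => a * (cos (theta + dot t x) * g1 x)
      + b * (cos (theta + dot t x) * g2 x))); first exact: trigpoly_lin.
  by apply/funext => x; ring.
rewrite (_ : (fun _ => _) = (fun x => a * (f1 x * g x) + b * (f2 x * g x))).
  exact: trigpoly_lin.
by apply/funext => x; ring.
Qed.

Lemma trigpolyD f g : trigpoly f -> trigpoly g -> trigpoly (fun x => f x + g x).
Proof.
move=> tf tg; rewrite (_ : (fun _ => _) = (fun x => 1 * f x + 1 * g x)).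
  exact: trigpoly_lin.
by apply/funext => x; rewrite !mul1r.
Qed.

Lemma trigpoly_bounded g : trigpoly g -> exists M : R, forall x, `|g x| <= M.
Proof.
elim=> [theta t|a b f1 f2 _ [M1 h1] _ [M2 h2]].
  by exists 1 => x; exact: cos_max.
exists (`|a| * M1 + `|b| * M2) => x; apply: (le_trans (ler_normD _ _)).
by rewrite !normrM lerD// ler_wpM2l.
Qed.

Lemma measurable_trigpoly g d (T : measurableType d) (X : T -> 'cV[R]_k) :
  trigpoly g -> (forall i, measurable_fun setT (fun w => X w i 0)) ->
  measurable_fun setT (fun w => g (X w)).
Proof.
move=> + mX; elim=> [theta t|a b f1 f2 _ m1 _ m2].
  exact: (measurable_cos_linear (fun i => t i 0) theta mX).
by apply: measurable_funD; exact: measurable_funM.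
Qed.

End trigonometric_polynomials.

Section bernstein_walk.
Context {R : realType}.
Variable k : nat.
Implicit Types (y : 'I_k -> R) (phi psi : 'cV[R]_k -> R) (z : 'cV[R]_k).

(** Expectation of [phi] at the end of a random walk started at [z] whose
    successive steps, listed by coordinate, move by [h] along coordinate [i]
    with probability [y i] and stay put otherwise. With [N] steps along each
    coordinate, [h = N^-1] and [z = 0] it is the multivariate Bernstein
    polynomial of [phi] of degree [N], evaluated at [y]. *)
Fixpoint walk (h : R) y phi (s : seq 'I_k) z : R :=
  if s is i :: s' then
    y i * walk h y phi s' (z + h *: delta_mx i 0) + (1 - y i) * walk h y phi s' z
  else phi z.

Lemma walk_lin h y a b phi psi s z :
  walk h y (fun u => a * phi u + b * psi u) s z =
  a * walk h y phi s z + b * walk h y psi s z.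
Proof. by elim: s z => [//|i s IH] z /=; rewrite !IH; ring. Qed.

Lemma walk_cst h y c s z : walk h y (fun=> c) s z = c.
Proof. by elim: s z => [//|i s IH] z /=; rewrite !IH; ring. Qed.

Lemma walk_mono h y phi psi s z : (forall i, 0 <= y i <= 1) ->
  (forall u, phi u <= psi u) -> walk h y phi s z <= walk h y psi s z.
Proof.
move=> y01 le; elim: s z => [//|i s IH] z /=.
case/andP: (y01 i) => y0 y1; apply: lerD; apply: ler_wpM2l => //.
by rewrite subr_ge0.
Qed.

Lemma walk_sum h y (phi : 'I_k -> 'cV[R]_k -> R) s z :
  walk h y (fun u => \sum_i phi i u) s z = \sum_i walk h y (phi i) s z.
Proof.
elim: s z => [//|i s IH] z /=; rewrite !IH !mulr_sumr -big_split/=.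
by apply: eq_bigr.
Qed.

Lemma walk_sqr h y (a : 'I_k) (c : R) s z :
  walk h y (fun u => (u a 0 - c) ^+ 2) s z =
  (z a 0 + h * (count_mem a s)%:R * y a - c) ^+ 2 +
  h ^+ 2 * (count_mem a s)%:R * (y a * (1 - y a)).
Proof.
elim: s z => [|i s IH] z /=; first by rewrite !mulr0 !mul0r !addr0.
rewrite !IH !mxE eqxx andbT; have [->|ia] := eqVneq i a.
  by rewrite natrD (_ : true%:R = 1 :> R)//; ring.
by rewrite add0n (_ : false%:R = 0 :> R)//; ring.
Qed.

Lemma trigpoly_walk h (y : 'cV[R]_k -> 'I_k -> R) phi s z :
  (forall i, trigpoly (fun x => y x i)) -> trigpoly (fun x => walk h (y x) phi s z).
Proof.
move=> ty; elim: s z => [|i s IH] z /=; first exact: trigpoly_cst.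
apply: trigpolyD; apply: trigpolyM => //.
rewrite (_ : (fun _ => _) = (fun x => 1 * 1 + (-1) * y x i)).
  by apply: trigpoly_lin => //; exact: trigpoly_cst.
by apply/funext => x; ring.
Qed.

Definition all_steps (N : nat) : seq 'I_k := flatten (nseq N (enum 'I_k)).

Lemma count_all_steps N (a : 'I_k) : count_mem a (all_steps N) = N.
Proof.
elim: N => [//|N IH]; rewrite /all_steps /= count_cat -/(all_steps N) IH.
by rewrite count_uniq_mem ?enum_uniq// mem_enum.
Qed.

(** Chebyshev's inequality for the walk: after [N] steps along each coordinate
    its position concentrates at [y]. *)
Lemma walk_concentration N y (F : 'cV[R]_k -> R) (c e K : R) : (0 < N)%N ->
  (forall i, 0 <= y i <= 1) -> 0 <= K ->
  (forall u, `|F u - c| <= e + K * \sum_a (u a 0 - y a) ^+ 2) ->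
  `|walk N%:R^-1 y F (all_steps N) 0 - c| <= e + K * (k%:R / N%:R).
Proof.
move=> N0 y01 K0 Fc; set h := N%:R^-1; set s := all_steps N.
have Nn0 : N%:R != 0 :> R by rewrite pnatr_eq0 -lt0n.
pose V (u : 'cV[R]_k) : R := \sum_a (u a 0 - y a) ^+ 2.
have sq : walk h y V s 0 <= k%:R * h.
  rewrite /V walk_sum (le_trans (y := \sum_(a < k) N%:R^-1))//; last first.
    by rewrite sumr_const card_ord mulr_natl.
  apply: ler_sum => a _; rewrite walk_sqr /s count_all_steps mxE add0r /h mulVf//.
  rewrite mul1r subrr expr0n/= add0r.
  have -> : N%:R^-1 ^+ 2 * N%:R = N%:R^-1 :> R by field.
  case/andP: (y01 a) => y0 y1; rewrite ler_piMr ?invr_ge0//.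
  by rewrite -[leRHS]mul1r ler_pM// ?subr_ge0// gerBl.
have up : walk h y F s 0 <= walk h y (fun u => 1 * (c + e) + K * V u) s 0.
  apply: walk_mono => // u; have := Fc u; rewrite ler_norml => /andP[_].
  by rewrite -/(V u) mul1r; lra.
have lo : walk h y (fun u => 1 * (c - e) + (- K) * V u) s 0 <= walk h y F s 0.
  apply: walk_mono => // u; have := Fc u; rewrite ler_norml => /andP[+ _].
  by rewrite -/(V u) mul1r; lra.
rewrite !(walk_lin, walk_cst) mul1r in up lo.
have := ler_wpM2l K0 sq; rewrite ler_norml => h1; apply/andP; split; lra.
Qed.

End bernstein_walk.

Section uniform_approximation.
Context {R : realType}.
Variable k : nat.

Lemma cvg_mx_coord (T : Type) (F : set_system T) {FF : Filter F} m n
    (f : T -> 'M[R]_(m, n)) (A : 'M[R]_(m, n)) :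
  (forall i j, f x i j @[x --> F] --> A i j) -> f x @[x --> F] --> A.
Proof.
move=> cf B [Q AQ QB].
have h : \forall x \near F, forall ij : 'I_m * 'I_n, Q ij.1 ij.2 (f x ij.1 ij.2).
  by apply: filter_forall => -[i j] /=; exact: cf _ (AQ i j).
by apply: filterS h => x h; apply: QB => i j; exact: (h (i, j)).
Qed.

Lemma compact_box (L : R) : compact [set x : 'cV[R]_k | forall i, `|x i 0| <= L].
Proof.
have -> : [set x : 'cV[R]_k | forall i, `|x i 0| <= L] =
    (fun v : 'rV[R]_k => v^T) @` [set v : 'rV[R]_k | forall i, `[- L, L]%classic (v ord0 i)].
  apply/seteqP; split=> [x xL|_ [v vL <-]] /=.
    exists x^T; last by rewrite trmxK.
    by move=> i; rewrite mxE /= in_itv/= -ler_norml.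
  by move=> i; rewrite mxE; have := vL i; rewrite /= in_itv/= -ler_norml.
apply: continuous_compact; last first.
  by apply: (@rV_compact R k (fun=> `[- L, L]%classic)) => _; exact: segment_compact.
apply: continuous_subspaceT => v; apply: (@cvg_mx_coord _ (nbhs v) _) => i j.
rewrite mxE; under eq_cvg do rewrite mxE.
exact: coord_continuous.
Qed.

Variable f : 'cV[R]_k -> R.
Hypothesis cf : continuous f.
Variable M : R.
Hypothesis fM : forall x, `|f x| <= M.
Variable L : R.
Hypothesis L_gt0 : 0 < L.

(** The coordinates [(1 + sin (x_i / L)) / 2] in the unit cube determine [x] in
   the box [|x_i| <= L], because [1 <= pi / 2]. *)
Let cube_coord (x : 'cV[R]_k) (i : 'I_k) : R := (1 + sin (x i 0 / L)) / 2.

Let uncube (z : 'cV[R]_k) : 'cV[R]_k := \col_i (L * asin (2 * z i 0 - 1)).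

Let box := [set x : 'cV[R]_k | forall i, `|x i 0| <= L].

Let cube_coord01 x i : 0 <= cube_coord x i <= 1.
Proof.
rewrite /cube_coord; have := sin_le1 (x i 0 / L); have := sin_geN1 (x i 0 / L).
by move=> *; apply/andP; split; lra.
Qed.

Let cube_coord_cvg i : continuous (cube_coord ^~ i).
Proof.
move=> x; apply: (@cvgM _ _ (nbhs x) _); last exact: cvg_cst.
apply: cvgD; first exact: cvg_cst.
apply: (@cvg_comp _ _ _ (fun x' : 'cV[R]_k => x' i 0 / L) sin _ (nbhs (x i 0 / L))).
  by apply: cvgM; [exact: coord_continuous|exact: cvg_cst].
exact: continuous_sin.
Qed.

Let small_angle x i : box x -> - (pi / 2) < x i 0 / L < pi / 2.
Proof.
move=> /(_ i); rewrite -ltr_norml => xL.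
apply: (@le_lt_trans _ _ 1).
  by rewrite normrM normfV (gtr0_norm L_gt0) ler_pdivrMr// mul1r.
rewrite lt_neqAle pihalf_ge1 andbT; apply/eqP => h.
have := cos1_gt0 R; by rewrite h cos_pihalf ltxx.
Qed.

Let uncube_cvg x : box x ->
  uncube z @[z --> (\col_i cube_coord x i : 'cV[R]_k)] --> x.
Proof.
move=> bx; apply: (@cvg_mx_coord _ (nbhs (\col_i cube_coord x i : 'cV[R]_k)) _) => i j.
rewrite ord1.
under eq_cvg do rewrite mxE.
have xi := small_angle i bx.
have e : 2 * cube_coord x i - 1 = sin (x i 0 / L) by rewrite /cube_coord; field.
have -> : x i 0 = L * asin (2 * cube_coord x i - 1).
  rewrite e sinK; first by rewrite mulrC divfK// gt_eqF.
  by case/andP: xi => h1 h2; rewrite in_itv/= !ltW.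
apply: (@cvgM _ _ (nbhs (\col_i cube_coord x i : 'cV[R]_k)) _).
  exact: cvg_cst.
have c : {for 2 * cube_coord x i - 1, continuous (@asin R)}.
  apply: continuous_asin; rewrite e.
  case/andP: xi; set u := x i 0 / L => h1 h2.
  have pi0 : - (pi / 2) <= pi / 2 :> R by lra.
  have uI : u \in `[- (pi / 2), pi / 2] by rewrite in_itv/= !ltW.
  apply/andP; split; last first.
    by rewrite -[ltRHS](sin_pihalf R) ltr_sin// in_itv/= lexx pi0.
  by rewrite -[in ltLHS](sin_pihalf R) -sinN ltr_sin// in_itv/= lexx pi0.
apply: (@cvg_comp _ _ _ (fun z : 'cV[R]_k => 2 * z i 0 - 1) (@asin R) _
  (nbhs (2 * cube_coord x i - 1))); last exact: c.
apply: cvgB; last exact: cvg_cst.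
apply: cvgM; first exact: cvg_cst.
rewrite (_ : cube_coord x i = (\col_i cube_coord x i : 'cV[R]_k) i 0).
  exact: coord_continuous.
by rewrite mxE.
Qed.

(** The continuity of [f \o uncube] at the points of the cube that come from the
   box is uniform, by compactness of the box. *)
Let near_uniform (e : R) : 0 < e -> exists2 delta : R, 0 < delta &
  forall x, box x -> forall z : 'cV[R]_k,
    (forall i, `|z i 0 - cube_coord x i| < delta) -> `|f (uncube z) - f x| <= e.
Proof.
move=> e0.
pose Q (delta : R) x := forall z : 'cV[R]_k,
    (forall i, `|z i 0 - cube_coord x i| < delta) -> `|f (uncube z) - f x| <= e.
have : \forall delta \near 0^'+, box `<=` Q delta.
  have /compact_near_coveringP := @compact_box L.
  apply=> x bx.
  have e2 : 0 < e / 2 by rewrite divr_gt0.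
  have cF : f (uncube z) @[z --> (\col_i cube_coord x i : 'cV[R]_k)] --> f x.
    apply: (@cvg_comp _ _ _ uncube f _ (nbhs x)); last exact: cf.
    exact: uncube_cvg.
  have /cvgrPdist_lt/(_ _ e2)/nbhs_ballP[eta /= eta0 Heta] := cF.
  have /cvgrPdist_lt/(_ _ e2) near1 := @cf x.
  have eta2 : 0 < eta / 2 by rewrite divr_gt0.
  have near2 : \forall x' \near x, forall i, `|cube_coord x i - cube_coord x' i| < eta / 2.
    apply: (@filter_forall _ _ _ (nbhs x) _) => i.
    by have /cvgrPdist_lt/(_ _ eta2) := @cube_coord_cvg i x.
  near=> x' delta => z zd /=.
  have h1 : `|f x - f x'| < e / 2 by near: x'.
  have h2 : `|f x - f (uncube z)| < e / 2.
    apply: Heta; split => // i j; rewrite ord1 mxE /ball/=.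
    have h3 : `|cube_coord x i - cube_coord x' i| < eta / 2 by move: i; near: x'.
    have h4 : delta < eta / 2 by near: delta; exact: nbhs_right_lt.
    rewrite (_ : _ - _ = (cube_coord x i - cube_coord x' i) - (z i 0 - cube_coord x' i)); last by ring.
    apply: (le_lt_trans (ler_normB _ _)); rewrite [ltRHS]splitr.
    by apply: ltrD => //; exact: lt_trans (zd i) h4.
  rewrite (_ : _ - _ = (f x - f x') - (f x - f (uncube z))); last by ring.
  apply: (le_trans (ler_normB _ _)); rewrite [leRHS]splitr.
  by apply: ltW; apply: ltrD.
move=> H; near (0 : R)^'+ => delta; exists delta => //.
by move: (near H delta); apply.
Unshelve. all: by end_near. Qed.

(** Weierstrass approximation on a box by trigonometric polynomials with the
    same uniform bound on the whole space. *)
Lemma trig_approximation (e : R) : 0 < e -> exists2 g : 'cV[R]_k -> R, trigpoly g &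
  (forall x, `|g x| <= M) /\ (forall x : 'cV[R]_k, (forall i, `|x i 0| <= L) -> `|f x - g x| <= e).
Proof.
move=> e0; have e2 : 0 < e / 2 by rewrite divr_gt0.
have [delta d0 Hd] := near_uniform e2.
have M0 : 0 <= M by rewrite (le_trans _ (fM 0)).
(* [2 * M] bounds the error when some coordinate is at distance at least
   [delta]. *)
pose K := 2 * M / delta ^+ 2.
have K0 : 0 <= K by rewrite divr_ge0 ?sqr_ge0// mulr_ge0.
have [N N0 KN] : exists2 N, (0 < N)%N & K * (k%:R / N%:R) <= e / 2.
  exists (Num.bound (K * k%:R / (e / 2))).+1 => //.
  rewrite mulrA ler_pdivrMr ?ltr0n// [leRHS]mulrC -ler_pdivrMr//.
  apply: ltW; apply: (@lt_trans _ _ (Num.bound (K * k%:R / (e / 2)))%:R).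
    by apply: archi_boundP; rewrite divr_ge0 ?(ltW e2)// mulr_ge0.
  by rewrite ltr_nat.
pose F z := f (uncube z).
exists (fun x => walk N%:R^-1 (cube_coord x) F (all_steps k N) 0).
  apply: trigpoly_walk => i.
  rewrite (_ : (fun _ => _) = (fun x => 2^-1 * 1 +
      2^-1 * cos (- (pi / 2) + dot (L^-1 *: delta_mx i 0) x))).
    by apply: trigpoly_lin; [exact: trigpoly_cst|exact: trigpoly_cos].
  apply/funext => x; rewrite dot_delta [- _ + _]addrC cosBpihalf /cube_coord.
  by rewrite [L^-1 * _]mulrC; field.
split=> [x|x bx].
  rewrite ler_norml; apply/andP; split.
    rewrite -[leLHS](walk_cst N%:R^-1 (cube_coord x) (- M) (all_steps k N) 0).
    by apply: walk_mono => // u; have := fM (uncube u); rewrite ler_norml => /andP[].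
  rewrite -[leRHS](walk_cst N%:R^-1 (cube_coord x) M (all_steps k N) 0).
  by apply: walk_mono => // u; have := fM (uncube u); rewrite ler_norml => /andP[].
rewrite distrC.
apply: (@le_trans _ _ (e / 2 + K * (k%:R / N%:R))); last by lra.
apply: walk_concentration => // u.
have S0 : 0 <= \sum_a (u a 0 - cube_coord x a) ^+ 2.
  by apply: sumr_ge0 => i _; exact: sqr_ge0.
have [near_u|] := boolP [forall i, `|u i 0 - cube_coord x i| < delta].
  apply: (@le_trans _ _ (e / 2)); last by rewrite lerDl mulr_ge0.
  by apply: Hd => // i; move/forallP : near_u.
rewrite negb_forall => /existsP[i]; rewrite -leNgt => far.
apply: (@le_trans _ _ (2 * M)).
  by apply: (le_trans (ler_normB _ _)); have := fM (uncube u); have := fM x; lra.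
apply: (@le_trans _ _ (K * \sum_a (u a 0 - cube_coord x a) ^+ 2)); last first.
  by rewrite lerDr ltW.
rewrite /K mulrAC ler_pdivlMr ?exprn_gt0// ler_wpM2l ?mulr_ge0//.
rewrite (bigD1 i)//= -[leLHS]addr0 lerD ?sumr_ge0// => [|j _]; last exact: sqr_ge0.
by rewrite -[leRHS]real_normK ?num_real// lerXn2r ?nnegrE ?(ltW d0).
Qed.

End uniform_approximation.

(** * Continuity theorem *)

Section bounded_expectations.
Context {R : realType} (k : nat) d (T : measurableType d) (P : probability T R).
Variable X : T -> 'cV[R]_k.
Hypothesis mX : forall i, measurable_fun setT (fun w => X w i 0).

Definition outside (L : R) : set T := [set w | exists i, L < `|X w i 0|].

Lemma measurable_outside L : measurable (outside L).
Proof.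
have -> : outside L = \big[setU/set0]_(i < k) [set w | L < `|X w i 0|].
  rewrite -bigcup_seq; apply/seteqP; split=> [w [i wi]|w [i _ wi]].
    by exists i => //=; rewrite mem_index_enum.
  by exists i.
apply: bigsetU_measurable => i _.
have mn : measurable_fun setT (fun w => `|X w i 0|) by exact: measurableT_comp.
by rewrite -[X in measurable X]setTI; apply: measurable_fun_ltr.
Qed.

(** Continuous functions of a vector with measurable coordinates are
    measurable, being pointwise limits of trigonometric polynomials. *)
Lemma measurable_continuous_comp (f : 'cV[R]_k -> R) (M : R) : continuous f ->
  (forall x, `|f x| <= M) -> measurable_fun setT (fun w => f (X w)).
Proof.
move=> cf fM.
have approx n : {g : 'cV[R]_k -> R | trigpoly g /\
    forall x : 'cV[R]_k, (forall i, `|x i 0| <= n.+1%:R) -> `|f x - g x| <= n.+1%:R^-1}.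
  apply: cid; have n1 : (0 : R) < n.+1%:R by rewrite ltr0n.
  have n2 : (0 : R) < n.+1%:R^-1 by rewrite invr_gt0.
  by have [g tg [_ fg]] := trig_approximation cf fM n1 n2; exists g.
pose g n := sval (approx n).
apply: (@measurable_fun_cvg _ _ _ setT (fun n w => g n (X w))) => //.
  by move=> n; apply: measurable_trigpoly mX; exact: (svalP (approx n)).1.
move=> w _; apply/cvgrPdist_le => e e0.
near=> n; apply: (@le_trans _ _ n.+1%:R^-1).
  apply: (svalP (approx n)).2 => i.
  have : \sum_j `|X w j 0| <= n.+1%:R.
    apply: (@le_trans _ _ n%:R); last by rewrite ler_nat.
    by near: n; exact: nbhs_infty_ger.
  by apply: le_trans; rewrite (bigD1 i)//= lerDl sumr_ge0.
by apply: ltW; near: n; exact: (near_infty_natSinv_lt (PosNum e0)).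
Unshelve. all: by end_near. Qed.

Lemma Rintegral_approx (f g : 'cV[R]_k -> R) (M L e : R) : 0 <= e ->
  measurable_fun setT (fun w => f (X w)) -> measurable_fun setT (fun w => g (X w)) ->
  (forall x, `|f x| <= M) -> (forall x, `|g x| <= M) ->
  (forall x : 'cV[R]_k, (forall i, `|x i 0| <= L) -> `|f x - g x| <= e) ->
  `|\int[P]_w f (X w) - \int[P]_w g (X w)| <= e + 2 * M * fine (P (outside L)).
Proof.
move=> e0 mf mg fM gM fg.
have M0 : 0 <= M by rewrite (le_trans _ (fM 0)).
have mO := measurable_outside L.
have fi := bounded_integrable P mf (fun w => fM (X w)).
have gi := bounded_integrable P mg (fun w => gM (X w)).
have mfg : measurable_fun setT (fun w => f (X w) - g (X w)) by exact: measurable_funB.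
have fg2 w : `|f (X w) - g (X w)| <= 2 * M.
  by apply: (le_trans (ler_normB _ _)); have := fM (X w); have := gM (X w); lra.
have fgi := bounded_integrable P mfg fg2.
rewrite -RintegralB//; apply: (le_trans (le_normr_Rintegral measurableT fgi)).
pose h w := e + 2 * M * \1_(outside L) w.
have mI : measurable_fun setT (\1_(outside L) : T -> R) by exact: measurable_indic.
have ind1 w : `|\1_(outside L) w : R| <= 1.
  by rewrite indicE; case: (_ \in _); rewrite ?normr1 ?normr0.
have Ii := bounded_integrable P mI ind1.
have hE : \int[P]_w h w = e + 2 * M * fine (P (outside L)).
  rewrite /h RintegralD//; first last.
  - exact: (integrableZl measurableT (2 * M) Ii).
  - by apply: (bounded_integrable P (M := `|e|)).
  rewrite RintegralZl// Rintegral_cst// [X in e * fine X](@probability_setT _ _ _ P) mulr1.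
  by rewrite /Rintegral integral_indic// setIT.
rewrite -hE; apply: le_Rintegral => //.
- apply: (bounded_integrable P (M := 2 * M)) => [|x]; last by rewrite normr_id.
  exact: measurableT_comp.
- apply: (bounded_integrable P (M := e + 2 * M)) => [|w].
    by apply: measurable_funD => //; exact: measurable_funM.
  rewrite /h ger0_norm; last by rewrite addr_ge0// !mulr_ge0// indicE.
  by rewrite lerD2l ler_piMr ?mulr_ge0// (le_trans (ler_norm _)).
move=> w _; rewrite /h indicE; have [wO|wO] := pselect (outside L w).
  by rewrite mem_set// mulr1 (le_trans (fg2 w))// lerDr.
rewrite memNset// mulr0 addr0; apply: fg => i.
by rewrite leNgt; apply/negP => wi; apply: wO; exists i.
Qed.

End bounded_expectations.

Section tightness.
Context {R : realType} (k : nat).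

Lemma single_law_tight d (T : measurableType d) (Q : probability T R)
    (Y : T -> 'cV[R]_k) : (forall i, measurable_fun setT (fun w => Y w i 0)) ->
  forall e : R, 0 < e -> exists2 L0 : R, 0 < L0 &
    forall L, L0 <= L -> fine (Q (outside Y L)) <= e.
Proof.
move=> mY e e0.
have /fine_cvg/cvgrPdist_le/(_ _ e0) : Q (outside Y n%:R) @[n --> \oo] --> 0%:E.
  have -> : 0%:E = Q (\bigcap_n outside Y n%:R).
    rewrite (_ : \bigcap_n _ = set0) ?measure0//; apply/seteqP; split => // w Ow.
    have [i] := Ow (Num.bound (\sum_j `|Y w j 0|)) I; apply/negP; rewrite -leNgt.
    apply: (@le_trans _ _ (\sum_j `|Y w j 0|)).
      by rewrite (bigD1 i)//= lerDl sumr_ge0.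
    by apply: ltW; apply: archi_boundP; rewrite sumr_ge0.
  apply: nonincreasing_cvg_mu => //.
  - by rewrite (le_lt_trans (probability_le1 _ _)) ?ltry//; exact: measurable_outside.
  - by move=> n; exact: measurable_outside.
  - by apply: bigcap_measurable => // n _; exact: measurable_outside.
  - move=> n m nm; apply/subsetPset => w [i wi]; exists i.
    by apply: le_lt_trans wi; rewrite ler_nat.
move=> [N _ /(_ N (leqnn _))]/= h; exists N.+1%:R; first by rewrite ltr0n.
move=> L NL; move: h; rewrite sub0r normrN => /(le_trans (ler_norm _)); apply: le_trans.
have fin r : Q (outside Y r) \is a fin_num.
  by apply: fin_num_measure; exact: measurable_outside.
apply: fine_le => //; apply: le_measure; rewrite ?inE; [exact: measurable_outside..|].
move=> w [i wi]; exists i; apply: le_lt_trans wi; apply: le_trans NL.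
by rewrite ler_nat.
Qed.

End tightness.

(** Levy's continuity theorem for tight sequences: trigonometric polynomials
    approximate bounded continuous functions off a set of small probability. *)
Section continuity_theorem.
Context {R : realType} (k : nat).
Variables (d : nat -> measure_display) (T : forall n, measurableType (d n))
  (P : forall n, probability (T n) R) (X : forall n, T n -> 'cV[R]_k).
Variables (d' : measure_display) (T' : measurableType d') (Q : probability T' R)
  (Y : T' -> 'cV[R]_k).
Hypothesis mX : \forall n \near \oo,
  forall i, measurable_fun setT (fun w => @X n w i 0).
Hypothesis mY : forall i, measurable_fun setT (fun w => Y w i 0).
Hypothesis char_cvg : forall (theta : R) (t : 'cV[R]_k),
  \int[P n]_w cos (theta + dot t (@X n w)) @[n --> \oo] -->
  \int[Q]_w cos (theta + dot t (Y w)).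
Hypothesis X_tight : forall e : R, 0 < e -> exists2 L0 : R, 0 < L0 &
  \forall n \near \oo, forall L, L0 <= L -> fine (P n (outside (@X n) L)) <= e.

(** Convergence of characteristic functions extends by linearity. *)
Lemma trigpoly_integral_cvg (g : 'cV[R]_k -> R) : trigpoly g ->
  \int[P n]_w g (@X n w) @[n --> \oo] --> \int[Q]_w g (Y w).
Proof.
elim=> [theta t|a b f1 f2 t1 IH1 t2 IH2]; first exact: char_cvg.
have lin d0 (T0 : measurableType d0) (P0 : probability T0 R) (Z : T0 -> 'cV[R]_k) :
    (forall i, measurable_fun setT (fun w => Z w i 0)) ->
    \int[P0]_w (a * f1 (Z w) + b * f2 (Z w)) =
    a * \int[P0]_w f1 (Z w) + b * \int[P0]_w f2 (Z w).
  move=> mZ.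
  have [M1 h1] := trigpoly_bounded t1; have [M2 h2] := trigpoly_bounded t2.
  have i1 := bounded_integrable P0 (measurable_trigpoly t1 mZ) (fun w => h1 (Z w)).
  have i2 := bounded_integrable P0 (measurable_trigpoly t2 mZ) (fun w => h2 (Z w)).
  rewrite RintegralD//; first by rewrite !RintegralZl.
    exact: (integrableZl measurableT a i1).
  exact: (integrableZl measurableT b i2).
rewrite lin//.
have h : a * \int[P n]_w f1 (@X n w) + b * \int[P n]_w f2 (@X n w) @[n --> \oo] -->
    a * \int[Q]_w f1 (Y w) + b * \int[Q]_w f2 (Y w).
  by apply: cvgD; apply: cvgM => //; exact: cvg_cst.
apply: cvg_trans h; apply: near_eq_cvg; near=> n; rewrite lin//.
by near: n.
Unshelve. all: by end_near. Qed.

Lemma levy_continuity : cvg_in_distribution P (@X) Q Y.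
Proof.
move=> f cf [M fM].
have M0 : 0 <= M by rewrite (le_trans _ (fM 0)).
have mfY : measurable_fun setT (fun w => f (Y w)) by exact: measurable_continuous_comp fM.
have mfX : \forall n \near \oo, measurable_fun setT (fun w => f (@X n w)).
  by apply: filterS mX => n mXn; exact: measurable_continuous_comp fM.
have EFinR d0 (T0 : measurableType d0) (P0 : probability T0 R) (h : T0 -> R) :
    measurable_fun setT h -> (forall w, `|h w| <= M) ->
    (\int[P0]_w (h w)%:E = (\int[P0]_w h w)%:E)%E.
  move=> mh hM; rewrite /Rintegral fineK//; apply: integrable_fin_num => //.
  exact: bounded_integrable mh hM.
rewrite EFinR//.
suff h : \int[P n]_w f (@X n w) @[n --> \oo] --> \int[Q]_w f (Y w).
  apply: cvg_EFin; last exact: h.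
  by apply: filterS mfX => n mfn; rewrite EFinR.
apply/cvgrPdist_le => e e0.
(* The total error is at most [2 * (1 + 2 * M) * e1 + e1]. *)
pose e1 := e / (5 * (1 + 2 * M)).
have M1 : 0 < 1 + 2 * M by lra.
have e10 : 0 < e1 by rewrite divr_gt0// mulr_gt0.
have [L1 L10 tX] := X_tight e10.
have [L2 L20 tY] := single_law_tight Q mY e10.
pose L := Num.max L1 L2.
have L0 : 0 < L by rewrite lt_max L10.
have [g tg [gM fg]] := trig_approximation cf fM L0 e10.
have /cvgrPdist_le/(_ _ e10) cg := trigpoly_integral_cvg tg.
have close d0 (T0 : measurableType d0) (P0 : probability T0 R) (Z : T0 -> 'cV[R]_k) :
    (forall i, measurable_fun setT (fun w => Z w i 0)) ->
    fine (P0 (outside Z L)) <= e1 ->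
    `|\int[P0]_w f (Z w) - \int[P0]_w g (Z w)| <= (1 + 2 * M) * e1.
  move=> mZ oZ; apply: le_trans (Rintegral_approx P0 mZ (ltW e10) _ _ fM gM fg) _.
  - exact: measurable_continuous_comp fM.
  - exact: measurable_trigpoly.
  by rewrite [(1 + 2 * M) * e1]mulrDl mul1r lerD2l ler_wpM2l// mulr_ge0.
have cY : `|\int[Q]_w f (Y w) - \int[Q]_w g (Y w)| <= (1 + 2 * M) * e1.
  by apply: close => //; apply: tY; rewrite le_max lexx orbT.
near=> n.
have cX : `|\int[P n]_w f (@X n w) - \int[P n]_w g (@X n w)| <= (1 + 2 * M) * e1.
  apply: close; first by near: n.
  have : forall L', L1 <= L' -> fine (P n (outside (@X n) L')) <= e1 by near: n.
  by apply; rewrite le_max lexx.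
have cgn : `|\int[Q]_w g (Y w) - \int[P n]_w g (@X n w)| <= e1 by near: n.
have eE : 5 * ((1 + 2 * M) * e1) = e.
  by rewrite /e1; field; rewrite gt_eqF.
have e1le : e1 <= (1 + 2 * M) * e1.
  by rewrite [(1 + 2 * M) * e1]mulrDl mul1r lerDl mulr_ge0 ?(ltW e10)// mulr_ge0.
move: cX cY cgn; rewrite !ler_norml => /andP[a1 a2] /andP[a3 a4] /andP[a5 a6].
apply/andP; split; lra.
Unshelve. all: by end_near. Qed.

End continuity_theorem.

(** * Law of a sparse sign embedding *)

Section law_of_embedding.
Context {R : realType}.

Lemma borel_set1 (k : nat) (v : 'cV[R]_k) : borel [set v].
Proof.
move=> M [[M0 MC MU] GM].
have : open (~` [set v]).
  apply: closed_openC; apply: accessible_closed_set1.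
  exact/hausdorff_accessible/norm_hausdorff.
by move=> /GM /MC; rewrite setTD setCK.
Qed.

Lemma Rintegral_sum d (T : measurableType d) (mu : {measure set T -> \bar R})
    (I : Type) (s : seq I) (F : I -> T -> R) :
  (forall i, mu.-integrable setT (EFin \o F i)) ->
  \int[mu]_w (\sum_(i <- s) F i w) = \sum_(i <- s) \int[mu]_w F i w.
Proof.
move=> iF; elim: s => [|i s IH].
  rewrite big_nil; under eq_Rintegral do rewrite big_nil.
  by rewrite /Rintegral integral0.
rewrite big_cons -IH -RintegralD//.
  by apply: eq_Rintegral => w _; rewrite big_cons.
rewrite (_ : EFin \o _ = (fun w => \sum_(j <- s) (F j w)%:E)%E).
  by apply: (integrable_sum measurableT) => i0 _; exact: iF.
by apply/funext => w; rewrite /= sumEFin.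
Qed.

Variables m zeta : nat.
Hypothesis zeta_gt0 : (0 < zeta)%N.
Local Notation V := (sign_vector m zeta).
Local Notation column := (@sign_column R m zeta).

Let sqrt_zeta_neq0 : Num.sqrt zeta%:R != 0 :> R.
Proof. by rewrite gt_eqF// sqrtr_gt0 ltr0n. Qed.

Lemma sign_value_inj : injective (@sign_value R).
Proof.
have n11 : (1 : R) != -1 by rewrite -subr_eq0 opprK -mulr2n pnatr_eq0.
case=> [[]|] [[]|] //=; rewrite ?expr0 ?expr1 => /eqP; rewrite ?oppr_eq0 ?oner_eq0//.
- by rewrite eq_sym (negbTE n11).
- by rewrite (negbTE n11).
- by rewrite eq_sym oppr_eq0 oner_eq0.
- by rewrite eq_sym oner_eq0.
Qed.

Lemma sign_column_inj : injective column.
Proof.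
move=> x y xy; apply/val_inj/ffunP => i; apply: sign_value_inj.
have := congr1 (fun v : 'cV[R]_m => v i 0) xy; rewrite !mxE.
by apply: mulIf; rewrite invr_eq0.
Qed.

Lemma sign_columnsE : @sign_columns R m zeta = column @` setT.
Proof.
apply/seteqP; split=> [_ [f [f3 fz] <-]|_ [x _ <-]].
  pose x : {ffun 'I_m -> option bool} :=
    [ffun i => if f i 0 == 0 then None else Some (f i 0 == -1)].
  have xf i : sign_value (x i) = f i 0 :> R.
    rewrite ffunE; have := f3 i; rewrite !inE => /or3P[] /eqP ->.
    - by rewrite oppr_eq0 oner_eq0 eqxx /= expr1.
    - by rewrite eqxx.
    - rewrite oner_eq0 /= (_ : 1 == -1 :> R = false) ?expr0//.
      by apply/negbTE; rewrite -subr_eq0 opprK -mulr2n pnatr_eq0.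
  have xz : support_card x == zeta.
    rewrite -(eqr_nat R) -fz /support_card -sum1_card big_mkcond natr_sum/=.
    apply/eqP; apply: eq_bigr => i _.
    by rewrite inE -xf sign_value_sqr; case: (x i).
  exists (Sub x xz) => //; apply/colP => i.
  by rewrite !mxE /= xf mulrC.
exists (\col_i sign_value (sval x i)); last first.
  by apply/colP => i; rewrite !mxE mulrC.
split=> [i|]; last by under eq_bigr do rewrite mxE; exact: sum_sign_value_sqr.
by rewrite mxE; case: (sval x i) => [[]|]; rewrite /= ?expr0 ?expr1 !inE eqxx ?orbT.
Qed.

Lemma uniform_sign_columns d (T : measurableType d) (P : probability T R)
    (X : T -> 'cV[R]_m) : uniform_on P X (@sign_columns R m zeta) ->
  (0 < #|{: V}|)%N /\ forall x, P (X @^-1` [set column x]) = (#|{: V}|%:R^-1)%:E.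
Proof.
move=> [N [N0 FN PN]].
have VN : #|{: V}| = N.
  apply/card_eq_II.
  have VI : (`I_#|{: V}| #= [set: V])%card.
    have : [set: 'I_#|{: V}|] = (@enum_rank V) @` setT.
      apply/seteqP; split => // i _.
      by exists (enum_val i) => //; exact: enum_valK.
    move=> TI; apply: (card_eq_trans card_II); rewrite TI; apply: inj_card_eq.
    by move=> x y _ _; exact: enum_rank_inj.
  apply: (card_eq_trans VI); apply: card_eq_trans _ FN.
  rewrite sign_columnsE; apply/card_esym/inj_card_eq.
  by move=> x y _ _; exact: sign_column_inj.
rewrite VN; split=> // x; apply: PN.
by rewrite sign_columnsE; exists x.
Qed.

End law_of_embedding.

Section expectation_as_average.
Context {R : realType}.
Variables (m n zeta : nat) (d : measure_display) (T : measurableType d).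
Variables (P : probability T R) (S : T -> 'M[R]_(m, n)).
Hypothesis zeta_gt0 : (0 < zeta)%N.
Hypothesis SE : sparse_sign_embedding P zeta S.
Local Notation V := (sign_vector m zeta).
Local Notation sample := {ffun 'I_n -> V}.

Definition sample_mx (s : sample) : 'M[R]_(m, n) :=
  \matrix_(i, j) sign_column (R := R) (s j) i 0.

Definition sample_event (s : sample) : set T := [set w | S w = sample_mx s].

Lemma embedding_card_gt0 : (0 < n)%N -> (0 < #|{: V}|)%N.
Proof.
move=> n0; have [_ _ U] := SE.
by have [] := uniform_sign_columns zeta_gt0 (U (Ordinal n0)).
Qed.

Let sample_eventE s : sample_event s =
  \bigcap_(j in [set` [set: 'I_n]%SET])
    (fun w => col j (S w)) @^-1` [set sign_column (R := R) (s j)].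
Proof.
apply/seteqP; split=> [w /= Sw j _ /=|w Sw].
  by rewrite Sw; apply/colP => i; rewrite !mxE.
apply/matrixP => i j; have /colP/(_ i) := Sw j (finset.in_setT j).
by rewrite !mxE.
Qed.

Let measurable_sample_event s : measurable (sample_event s).
Proof.
have [mS _ _] := SE.
have -> : sample_event s =
    \bigcap_(ij in [set` [set: 'I_m * 'I_n]%SET])
      (fun w => S w ij.1 ij.2) @^-1` [set sample_mx s ij.1 ij.2].
  apply/seteqP; split=> [w /= Sw ij _ /=|w Sw]; first by rewrite Sw.
  by apply/matrixP => i j; exact: (Sw (i, j) (finset.in_setT _)).
apply: fin_bigcap_measurable => [|ij _]; first exact: finite_finset.
by rewrite -[X in measurable X]setTI; exact: mS.
Qed.

Lemma sample_event_prob s : (0 < #|{: V}|)%N ->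
  P (sample_event s) = (#|{: sample}|%:R^-1)%:E.
Proof.
move=> V0; have [_ ind U] := SE.
rewrite sample_eventE ind; last by move=> j; exact: borel_set1.
rewrite (eq_bigr (fun=> (#|{: V}|%:R^-1)%:E)); last first.
  by move=> j _; have [_ ->] := uniform_sign_columns zeta_gt0 (U j).
rewrite prodEFin prodr_const cardsT card_ord card_ffun card_ord natrX.
by rewrite exprVn.
Qed.

Lemma sample_mx_inj : injective sample_mx.
Proof.
move=> s t st; apply/ffunP => j; apply: (@sign_column_inj R m zeta zeta_gt0).
apply/colP => i; have /matrixP/(_ i j) := st.
by rewrite !mxE.
Qed.

(** The columns are independent and uniform, so the embedding takes each value
    [sample_mx s] with the same probability and almost surely no other. *)
Lemma expectation_sample (G : 'M[R]_(m, n) -> R) (M : R) : (0 < #|{: V}|)%N ->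
  measurable_fun setT (fun w => G (S w)) -> (forall A, `|G A| <= M) ->
  \int[P]_w G (S w) = avg (fun s => G (sample_mx s)).
Proof.
move=> V0 mG GM; have S0 : (0 < #|{: sample}|)%N by exact: sample_gt0.
have Sn0 : #|{: sample}|%:R != 0 :> R by rewrite pnatr_eq0 -lt0n.
pose I s : T -> R := \1_(sample_event s).
have mI s : measurable_fun setT (I s) by exact: measurable_indic.
have I1 s w : `|I s w| <= 1.
  by rewrite /I indicE; case: (_ \in _); rewrite ?normr1 ?normr0.
have iI s := bounded_integrable P (mI s) (I1 s).
have intI s : \int[P]_w I s w = #|{: sample}|%:R^-1.
  by rewrite /Rintegral integral_indic// setIT [X in fine X]sample_event_prob.
have iG := bounded_integrable P mG (fun w => GM (S w)).
pose tot w := \sum_s I s w; pose GI w := \sum_s G (sample_mx s) * I s w.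
have itot : P.-integrable setT (EFin \o tot).
  rewrite (_ : EFin \o _ = (fun w => \sum_s (I s w)%:E)%E).
    by apply: (integrable_sum measurableT) => s _; exact: iI.
  by apply/funext => w; rewrite /= sumEFin.
have iGIs s : P.-integrable setT (EFin \o (fun w => G (sample_mx s) * I s w)).
  exact: (integrableZl measurableT (G (sample_mx s)) (iI s)).
have iGI : P.-integrable setT (EFin \o GI).
  rewrite (_ : EFin \o _ = (fun w => \sum_s (G (sample_mx s) * I s w)%:E)%E).
    by apply: (integrable_sum measurableT) => s _; exact: iGIs.
  by apply/funext => w; rewrite /= sumEFin.
have inttot : \int[P]_w tot w = 1.
  rewrite /tot Rintegral_sum// (eq_bigr _ (fun s _ => intI s)) sumr_const.
  by rewrite -[_ *+ _]mulr_natl divff.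
have intGI : \int[P]_w GI w = avg (fun s => G (sample_mx s)).
  rewrite /GI Rintegral_sum// /avg mulr_suml; apply: eq_bigr => s _.
  by rewrite RintegralZl// intI.
have close w : `|G (S w) - GI w| <= M * (1 - tot w).
  have [[s Ss]|none] := pselect (exists s, sample_event s w).
    have Is : I s w = 1 by rewrite /I indicE mem_set.
    have It t : t != s -> I t w = 0.
      move=> ts; rewrite /I indicE memNset// => St.
      move/eqP: ts; apply; apply: sample_mx_inj.
      by move: St Ss; rewrite /sample_event/= => -> .
    rewrite /GI /tot (bigD1 s)//= [in X in _ <= X](bigD1 s)//= Is.
    rewrite !big1 => [|t ts|t ts]; rewrite ?It ?mulr0//.
    by rewrite !addr0 mulr1 subrr mulr0 Ss subrr normr0.
  have I0 s : I s w = 0.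
    by rewrite /I indicE memNset// => Ss; apply: none; exists s.
  rewrite /GI /tot !big1 => [|s _|s _]; rewrite ?I0 ?mulr0//.
  by rewrite !subr0 mulr1.
(* [GI] agrees with [G (S w)] on the sample events, whose total probability
   is 1, so the gap [1 - tot] has integral 0. *)
rewrite -intGI; apply/eqP; rewrite -subr_eq0 -normr_le0 -RintegralB//.
have iB : P.-integrable setT (EFin \o (fun w => G (S w) - GI w)).
  rewrite (_ : EFin \o _ = (fun w => (G (S w))%:E - (GI w)%:E)%E).
    exact: integrableB.
  by apply/funext => w; rewrite /= EFinB.
apply: (le_trans (le_normr_Rintegral measurableT iB)).
have i1 : P.-integrable setT (EFin \o (fun=> 1 : R)).
  by apply: (bounded_integrable P (M := `|1|)).
have i1tot : P.-integrable setT (EFin \o (fun w => 1 - tot w)).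
  rewrite (_ : EFin \o _ = (fun w => 1%:E - (tot w)%:E)%E).
    exact: integrableB.
  by apply/funext => w; rewrite /= EFinB.
have -> : 0 = \int[P]_w (M * (1 - tot w)).
  rewrite RintegralZl// RintegralB// inttot Rintegral_cst// [X in 1 * fine X](@probability_setT _ _ _ P).
  by rewrite mulr1 subrr mulr0.
apply: le_Rintegral => //; first by have := integrable_abse iB.
exact: (integrableZl measurableT M i1tot).
Qed.

End expectation_as_average.

(** * The error as a quadratic form in the columns *)

Section vec_sums.
Context {R : realType}.

Definition coef_mx (p : nat) (t : 'cV[R]_(p * p)) : 'M[R]_p :=
  \matrix_(i, j) t (vec_index i j) 0.

Lemma sum_vec_index (p : nat) (F : 'I_(p * p) -> R) :
  \sum_a F a = \sum_i \sum_j F (vec_index i j).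
Proof.
rewrite (reindex _ (curry_mxvec_bij p p))/= exchange_big /= pair_bigA/=.
by apply: eq_bigr => -[i j].
Qed.

Lemma dot_vec (p : nat) (t : 'cV[R]_(p * p)) (A : 'M[R]_p) :
  dot t (vec A) = \tr ((coef_mx t)^T *m A).
Proof.
rewrite /dot sum_vec_index exchange_big; apply: eq_bigr => j _.
by rewrite mxE; apply: eq_bigr => i _; rewrite vecE !mxE.
Qed.

Lemma trmx_mul_tr (m n : nat) (A B : 'M[R]_(m, n)) :
  \tr (A^T *m B) = \sum_i \sum_j A i j * B i j.
Proof.
rewrite exchange_big; apply: eq_bigr => j _.
by rewrite mxE; apply: eq_bigr => i _; rewrite mxE.
Qed.

Lemma sum_off_diagonal (n : nat) (F : 'I_n -> 'I_n -> R) :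
  \sum_i \sum_j F i j =
  \sum_i F i i + \sum_(j < n) \sum_(i < n | (i < j)%N) (F i j + F j i).
Proof.
have split_j (j : 'I_n) : \sum_i F i j =
    F j j + (\sum_(i < n | (i < j)%N) F i j + \sum_(i < n | (j < i)%N) F i j).
  rewrite (bigD1 j)//=; congr (_ + _); rewrite (bigID (fun i : 'I_n => (i < j)%N))/=.
  by congr (_ + _); apply: eq_bigl => i; rewrite -(inj_eq val_inj)/=; case: ltngtP.
rewrite exchange_big/= (eq_bigr _ (fun j _ => split_j j)) big_split/=; congr (_ + _).
rewrite big_split/= [X in _ + X](exchange_big_dep predT)//= -big_split/=.
by apply: eq_bigr => j _; rewrite -big_split.
Qed.

End vec_sums.

Section quadratic_form.
Context {R : realType}.
Variables (m n p zeta : nat) (U : 'M[R]_(n, p)).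
Hypothesis zeta_gt0 : (0 < zeta)%N.
Hypothesis UU : U^T *m U = 1%:M.
Local Notation V := (sign_vector m zeta).
Hypothesis V_gt0 : (0 < #|{: V}|)%N.
Local Notation sample := {ffun 'I_n -> V}.
Implicit Types t : 'cV[R]_(p * p).

Definition embedding_error (S : 'M[R]_(m, n)) : 'cV[R]_(p * p) :=
  Num.sqrt m%:R *: vec (U^T *m S^T *m S *m U - 1%:M).

Definition sym_coef t : 'M[R]_p := coef_mx t + (coef_mx t)^T.

Definition coef_norm t : R := \sum_k \sum_l sym_coef t k l ^+ 2.

Definition form_mx t : 'M[R]_n := U *m sym_coef t *m U^T.

Definition row_sq (i : 'I_n) : R := \sum_k U i k ^+ 2.

(** Here [row_sq i] is the i-th leverage score of [U]; the scores sum to [p]. *)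
Definition leverage : R := \sum_i row_sq i ^+ 2.

(** The diagonal of the Gram matrix of the sketch is exactly 1, so that the
    error is an off-diagonal quadratic form in the columns. *)
Lemma embedding_error_mart t (s : sample) :
  dot t (embedding_error (sample_mx s)) = mart (form_mx t) n s.
Proof.
set S := sample_mx s; pose G := S^T *m S; pose W := U *m (coef_mx t)^T *m U^T.
have GE i j : G i j = dot (sign_column (s i)) (sign_column (s j)).
  by rewrite mxE; apply: eq_bigr => k _; rewrite !mxE.
have Gii i : G i i = 1.
  by rewrite GE -[RHS](normsq_chi zeta_gt0 (s i)); apply: eq_bigr => k _; rewrite expr2.
have Gsym i j : G i j = G j i.
  by rewrite !GE; apply: eq_bigr => k _; rewrite mulrC.
have -> : dot t (embedding_error S) =
    Num.sqrt m%:R * dot t (vec (U^T *m S^T *m S *m U - 1%:M)).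
  by rewrite /dot mulr_sumr; apply: eq_bigr => a _; rewrite mxE mulrCA.
rewrite /mart sum_lt_full dot_vec; congr (_ * _).
have -> : U^T *m S^T *m S *m U - 1%:M = U^T *m (G - 1%:M) *m U.
  by rewrite mulmxBr mulmxBl mulmx1 UU !mulmxA.
have -> : \tr ((coef_mx t)^T *m (U^T *m (G - 1%:M) *m U)) = \tr (W *m (G - 1%:M)).
  by rewrite mulmxA mxtrace_mulC !mulmxA.
have Eii i : (G - 1%:M) i i = 0 by rewrite [LHS]mxE Gii mxE mxE eqxx subrr.
have Eij i j : i != j -> (G - 1%:M) i j = G i j.
  by move=> /negbTE ij; rewrite [LHS]mxE [X in _ + X]mxE [X in _ - X]mxE ij subr0.
rewrite -[W]trmxK trmx_mul_tr sum_off_diagonal big1 ?add0r => [|i _]; last first.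
  by rewrite Eii mulr0.
have formE i j : form_mx t i j = W^T i j + W^T j i.
  have -> : form_mx t = W^T + W.
    rewrite /form_mx /sym_coef mulmxDr mulmxDl /W !trmx_mul !trmxK.
    by rewrite !mulmxA.
  by rewrite !mxE.
apply: eq_bigr => j _.
transitivity (\sum_(i < n | (i < j)%N) form_mx t i j * G i j).
  apply: eq_bigr => i ij.
  have nij : i != j by rewrite -(inj_eq val_inj)/= ltn_eqF.
  have nji : j != i by rewrite eq_sym.
  by rewrite (Eij i j nij) (Eij j i nji) [G j i]Gsym -mulrDl formE.
rewrite /dot /comb.
under [RHS]eq_bigr do rewrite summxE mulr_suml.
rewrite exchange_big/=; apply: eq_bigr => i ij.
rewrite GE /dot mulr_sumr; apply: eq_bigr => k _.
by rewrite !mxE mulrA.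
Qed.

Lemma sum_row_sq : \sum_i row_sq i = p%:R.
Proof.
have := congr1 (fun A => \tr A) UU; rewrite /= mxtrace1 => <-.
by rewrite trmx_mul_tr; apply: eq_bigr => i _; apply: eq_bigr => j _; rewrite expr2.
Qed.

Lemma row_sq_ge0 i : 0 <= row_sq i.
Proof. by apply: sumr_ge0 => k _; exact: sqr_ge0. Qed.

Lemma leverage_ge0 : 0 <= leverage.
Proof. by apply: sumr_ge0 => i _; exact: sqr_ge0. Qed.

Lemma leverage_le : leverage <= p%:R * \sum_(i < n) \sum_(j < p) U i j ^+ 4.
Proof.
rewrite mulr_sumr; apply: ler_sum => i _.
apply: (le_trans (sqr_sum_le (fun k => U i k ^+ 2))); rewrite card_ord.
by rewrite ler_wpM2l ?ler0n// ler_sum// => k _; rewrite -exprM.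
Qed.

Definition form_cst t : R := (p * p)%:R * coef_norm t.

Lemma form_cst_ge0 t : 0 <= form_cst t.
Proof.
rewrite mulr_ge0 ?ler0n//; apply: sumr_ge0 => k _; apply: sumr_ge0 => l _.
exact: sqr_ge0.
Qed.

Lemma form_mx_sqr_le t i j : form_mx t i j ^+ 2 <= form_cst t * (row_sq i * row_sq j).
Proof.
have -> : form_mx t i j = \sum_(kl : 'I_p * 'I_p) U i kl.1 * sym_coef t kl.1 kl.2 * U j kl.2.
  rewrite -(pair_bigA _ (fun k l => U i k * sym_coef t k l * U j l))/= mxE exchange_big/=.
  by apply: eq_bigr => l _; rewrite mxE mulr_suml; apply: eq_bigr => k _; rewrite !mxE.
apply: (le_trans (sqr_sum_le _)); rewrite card_prod card_ord /form_cst -mulrA.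
apply: ler_wpM2l; rewrite ?ler0n//.
rewrite -(pair_bigA _ (fun k l => (U i k * sym_coef t k l * U j l) ^+ 2))/=.
rewrite /coef_norm mulr_suml; apply: ler_sum => k _; rewrite mulr_suml.
apply: ler_sum => l _; rewrite !exprMn.
have h (a : 'I_n) (b : 'I_p) : U a b ^+ 2 <= row_sq a.
  by rewrite /row_sq (bigD1 b)//= lerDl sumr_ge0// => c _; exact: sqr_ge0.
rewrite mulrAC [leLHS]mulrC ler_wpM2l ?sqr_ge0// ler_pM ?sqr_ge0//.
Qed.

Let sum_row_sq_lt (j : 'I_n) : 0 <= \sum_(i < n | (i < j)%N) row_sq i <= p%:R.
Proof.
apply/andP; split; first by apply: sumr_ge0 => i _; exact: row_sq_ge0.
rewrite -sum_row_sq [leRHS](bigID (fun i : 'I_n => (i < j)%N))/= lerDl.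
by apply: sumr_ge0 => i _; exact: row_sq_ge0.
Qed.

Lemma var_step_le t j : var_step (form_mx t) j <= form_cst t * p%:R * row_sq j.
Proof.
apply: (@le_trans _ _ (\sum_(i < n | (i < j)%N) form_cst t * (row_sq i * row_sq j))).
  by apply: ler_sum => i _; exact: form_mx_sqr_le.
rewrite -mulr_sumr -mulr_suml -[leRHS]mulrA; apply: ler_wpM2l; first exact: form_cst_ge0.
by rewrite ler_wpM2r ?row_sq_ge0//; case/andP: (sum_row_sq_lt j).
Qed.

Lemma sum_var_step_le t : \sum_j var_step (form_mx t) j <= form_cst t * p%:R ^+ 2.
Proof.
apply: (le_trans (ler_sum _ (fun j _ => var_step_le t j))).
by rewrite -mulr_sumr sum_row_sq -mulrA -expr2.
Qed.

Lemma sum_var_step_sqr_le t : \sum_j var_step (form_mx t) j ^+ 2 <=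
  (form_cst t * p%:R) ^+ 2 * leverage.
Proof.
rewrite mulr_sumr; apply: ler_sum => j _; rewrite -exprMn.
rewrite lerXn2r ?nnegrE ?var_step_ge0 ?var_step_le//.
by rewrite mulr_ge0 ?row_sq_ge0// mulr_ge0 ?form_cst_ge0.
Qed.

Lemma sum_weight4_le t : \sum_j weight4 ((form_mx t)^~ j) j <=
  form_cst t ^+ 2 * leverage ^+ 2.
Proof.
rewrite [leverage ^+ 2]expr2 {2}/leverage !mulr_sumr; apply: ler_sum => j _.
rewrite /leverage mulr_suml mulr_sumr.
apply: (@le_trans _ _ (\sum_(i < n | (i < j)%N) form_cst t ^+ 2 * (row_sq i ^+ 2 * row_sq j ^+ 2))).
  apply: ler_sum => i _; rewrite -[form_mx t i j ^+ 4]/(form_mx t i j ^+ (2 * 2)) exprM -!exprMn.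
  rewrite lerXn2r ?nnegrE ?sqr_ge0 ?form_mx_sqr_le//.
  by rewrite mulr_ge0 ?form_cst_ge0// mulr_ge0 ?row_sq_ge0.
rewrite [leRHS](bigID (fun i : 'I_n => (i < j)%N))/= lerDl.
by apply: sumr_ge0 => i _; rewrite mulr_ge0 ?sqr_ge0// mulr_ge0 ?sqr_ge0.
Qed.

(** The Frobenius norm of [U A U^T] is that of [A], and the form loses only its
    diagonal. *)
Lemma sum_var_stepE t : \sum_j var_step (form_mx t) j =
  (coef_norm t - \sum_i form_mx t i i ^+ 2) / 2.
Proof.
have sym i j : form_mx t i j = form_mx t j i.
  have symT : (form_mx t)^T = form_mx t.
    rewrite /form_mx !trmx_mul trmxK mulmxA; congr (_ *m _ *m _).
    by rewrite /sym_coef linearD/= trmxK addrC.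
  by rewrite -[in LHS]symT mxE.
have tot : \sum_i \sum_j form_mx t i j ^+ 2 = coef_norm t.
  rewrite /coef_norm.
  transitivity (\tr ((form_mx t)^T *m form_mx t)).
    by rewrite trmx_mul_tr; apply: eq_bigr => i _; apply: eq_bigr => j _; rewrite expr2.
  transitivity (\tr ((sym_coef t)^T *m sym_coef t)); last first.
    by rewrite trmx_mul_tr; apply: eq_bigr => i _; apply: eq_bigr => j _; rewrite expr2.
  rewrite /form_mx !trmx_mul trmxK -!mulmxA [U^T *m (U *m _)]mulmxA UU mul1mx.
  by rewrite mxtrace_mulC -!mulmxA UU mulmx1.
rewrite -tot sum_off_diagonal addrAC subrr add0r mulr_suml; apply: eq_bigr => j _.
rewrite mulr_suml; apply: eq_bigr => i _.
by rewrite [form_mx t j i]sym; field.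
Qed.

Lemma diag_form_le t : 0 <= \sum_i form_mx t i i ^+ 2 <= form_cst t * leverage.
Proof.
apply/andP; split; first by apply: sumr_ge0 => i _; exact: sqr_ge0.
rewrite mulr_sumr; apply: ler_sum => i _.
by rewrite [row_sq i ^+ 2]expr2; exact: form_mx_sqr_le.
Qed.

Lemma sum_step_error_le t (e : R) : 0 < e ->
  \sum_j step_error m zeta (form_mx t) e j <=
  2 * (form_cst t * p%:R ^+ 2) / Num.sqrt m%:R +
  (form_cst t * p%:R) ^+ 2 * leverage + e * (form_cst t * p%:R ^+ 2) +
  (1 + e^-1) * (33 * ((form_cst t * p%:R) ^+ 2 * leverage) +
     3 * (m%:R / zeta%:R ^+ 2) * (form_cst t ^+ 2 * leverage ^+ 2)).
Proof.
move=> e0; rewrite /step_error !big_split/= -mulr_suml -!mulr_sumr big_split/= -!mulr_sumr.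
have e1 : 0 <= 1 + e^-1 by rewrite addr_ge0// invr_ge0 ltW.
apply: lerD; first apply: lerD; first apply: lerD.
- rewrite ler_wpM2r ?invr_ge0 ?sqrtr_ge0// ler_wpM2l//; exact: sum_var_step_le.
- exact: sum_var_step_sqr_le.
- by rewrite ler_wpM2l ?(ltW e0)//; exact: sum_var_step_le.
apply: ler_wpM2l => //; apply: lerD.
  by rewrite ler_wpM2l//; exact: sum_var_step_sqr_le.
apply: ler_wpM2l; last exact: sum_weight4_le.
by rewrite mulr_ge0// divr_ge0// sqr_ge0.
Qed.

End quadratic_form.

(** * The limit law *)

Section gaussian_limit.
Context {R : realType}.
Variable p : nat.
Local Notation Pmx := (commutation_mx R p).

Lemma mul_commutation_mx (k : nat) (M : 'M[R]_(p * p, k)) (i j : 'I_p) b :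
  (Pmx *m M) (vec_index i j) b = M (vec_index j i) b.
Proof.
rewrite mxE sum_vec_index (bigD1 j)//= [X in _ + X]big1 => [|k' kj].
  rewrite addr0 (bigD1 i)//= big1 => [|l li].
    by rewrite commutation_mxE !eqxx !mul1r addr0.
  by rewrite commutation_mxE eq_sym (negbTE li) !mul0r.
by rewrite big1// => l _; rewrite commutation_mxE [j == k']eq_sym (negbTE kj) mulr0 mul0r.
Qed.

Lemma vec_indexP (a : 'I_(p * p)) : exists i j : 'I_p, a = vec_index i j.
Proof. by case/mxvec_indexP: a => j i; exists i, j. Qed.

Lemma vec_index_eq (i j k l : 'I_p) :
  (vec_index i j == vec_index k l) = (i == k) && (j == l).
Proof.
apply/eqP/andP => [h|[/eqP -> /eqP ->]//].
have := vec_indexK i j; rewrite h vec_indexK => -[-> ->].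
by rewrite !eqxx.
Qed.

Lemma commutation_mx_tr : Pmx^T = Pmx.
Proof.
apply/matrixP => a b; have [i [j ->]] := vec_indexP a.
have [k [l ->]] := vec_indexP b; rewrite mxE !commutation_mxE.
by rewrite mulrC [l == i]eq_sym [k == j]eq_sym.
Qed.

Lemma commutation_mxK : Pmx *m Pmx = 1%:M.
Proof.
apply/matrixP => a b; have [i [j ->]] := vec_indexP a.
have [k [l ->]] := vec_indexP b; rewrite mul_commutation_mx commutation_mxE.
by rewrite mxE vec_index_eq mulrC; do 2 case: eqP; rewrite ?mulr1 ?mulr0.
Qed.

(** The commutation matrix is a symmetric involution, so half of
    [1 + commutation_mx] is an orthogonal projection. *)
Definition covariance_root : 'M[R]_(p * p) := (Num.sqrt 2)^-1 *: (1%:M + Pmx).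

Let sqrt2 : (Num.sqrt 2 : R) ^+ 2 = 2.
Proof. by rewrite sqr_sqrtr. Qed.

Lemma covariance_root_tr : covariance_root^T = covariance_root.
Proof. by rewrite /covariance_root linearZ/= linearD/= trmx1 commutation_mx_tr. Qed.

Lemma covariance_rootE : covariance_root *m covariance_root^T = 1%:M + Pmx.
Proof.
rewrite covariance_root_tr /covariance_root -scalemxAl -scalemxAr scalerA.
rewrite mulmxDl !mulmxDr !mul1mx mulmx1 commutation_mxK [Pmx + 1%:M]addrC.
rewrite -mulr2n -[(1%:M + Pmx) *+ 2]scaler_nat scalerA -invfM -expr2 sqrt2.
by rewrite mulVf ?scale1r.
Qed.

Lemma covariance_root_norm (t : 'cV[R]_(p * p)) :
  \sum_a (covariance_root^T *m t) a 0 ^+ 2 = coef_norm t / 2.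
Proof.
rewrite sum_vec_index /coef_norm mulr_suml; apply: eq_bigr => i _.
rewrite mulr_suml; apply: eq_bigr => j _.
rewrite covariance_root_tr /covariance_root -scalemxAl mulmxDl mul1mx.
rewrite mxE [X in _ * X]mxE mul_commutation_mx /sym_coef !mxE.
by rewrite exprMn exprVn sqrt2 mulrC.
Qed.

Lemma gaussian_vector_coord (z : (p * p).-tuple (measurableTypeR R)) a :
  gaussian_vector 0 covariance_root z a 0 = \sum_i covariance_root a i * tnth z i.
Proof. by rewrite /gaussian_vector add0r mxE; apply: eq_bigr => i _; rewrite [X in _ * X]mxE. Qed.

Lemma dot_gaussian_vector (t : 'cV[R]_(p * p)) (z : (p * p).-tuple (measurableTypeR R)) :
  dot t (gaussian_vector 0 covariance_root z) =
  \sum_i (covariance_root^T *m t) i 0 * tnth z i.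
Proof.
rewrite /dot; under eq_bigr do rewrite gaussian_vector_coord mulr_sumr.
rewrite exchange_big; apply: eq_bigr => i _; rewrite mxE mulr_suml.
by apply: eq_bigr => a _; rewrite [(_^T) _ _]mxE mulrCA mulrA.
Qed.

Lemma measurable_gaussian_vector a : measurable_fun setT
  (fun z => gaussian_vector 0 covariance_root z a 0).
Proof.
under eq_fun do rewrite gaussian_vector_coord.
apply: measurable_sum => i; apply: measurable_funM => //.
exact: measurable_tnth.
Qed.

Lemma gaussian_vector_char (theta : R) (t : 'cV[R]_(p * p)) :
  \int[std_normal R (p * p)]_z cos (theta + dot t (gaussian_vector 0 covariance_root z)) =
  expR (- (coef_norm t / 2 / 2)) * cos theta.
Proof.
rewrite /Rintegral; under eq_integral do rewrite dot_gaussian_vector.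
by rewrite std_normal_char covariance_root_norm.
Qed.

End gaussian_limit.

(** * Convergence of the sketch *)

Section embedding_bounds.
Context {R : realType}.
Variables (m n p zeta : nat) (d : measure_display) (T : measurableType d).
Variables (P : probability T R) (S : T -> 'M[R]_(m, n)) (U : 'M[R]_(n, p)).
Hypothesis zeta_gt0 : (0 < zeta)%N.
Hypothesis n_gt0 : (0 < n)%N.
Hypothesis SE : sparse_sign_embedding P zeta S.
Hypothesis UU : U^T *m U = 1%:M.
Local Notation V := (sign_vector m zeta).
Local Notation error w := (embedding_error U (S w)).

Let V_gt0 : (0 < #|{: V}|)%N.
Proof. exact: embedding_card_gt0 SE n_gt0. Qed.

Let measurable_mulmx (a b c : nat) (A : T -> 'M[R]_(a, b)) (B : T -> 'M[R]_(b, c)) :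
  (forall i j, measurable_fun setT (fun w => A w i j)) ->
  (forall i j, measurable_fun setT (fun w => B w i j)) ->
  forall i j, measurable_fun setT (fun w => (A w *m B w) i j).
Proof.
move=> mA mB i j; under eq_fun do rewrite mxE.
by apply: measurable_sum => k; exact: measurable_funM.
Qed.

Lemma measurable_embedding_error a : measurable_fun setT (fun w => error w a 0).
Proof.
have [mS _ _] := SE; have [i [j ->]] := vec_indexP a.
under eq_fun do rewrite mxE vecE mxE.
apply: measurable_funM => //; apply: measurable_funD => //.
apply: measurable_mulmx => // {}i {}j; apply: measurable_mulmx => // {}i {}j.
apply: measurable_mulmx => // {}i {}j.
under eq_fun do rewrite mxE.
exact: mS.
Qed.

Lemma embedding_char_bound (theta e : R) (t : 'cV[R]_(p * p)) : 0 < e ->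
  `|\int[P]_w cos (theta + dot t (error w)) -
    expR (- ((coef_norm t - \sum_i form_mx U t i i ^+ 2) / 2 / 2)) * cos theta| <=
  2 * (form_cst t * p%:R ^+ 2) / Num.sqrt m%:R +
  (form_cst t * p%:R) ^+ 2 * leverage U + e * (form_cst t * p%:R ^+ 2) +
  (1 + e^-1) * (33 * ((form_cst t * p%:R) ^+ 2 * leverage U) +
     3 * (m%:R / zeta%:R ^+ 2) * (form_cst t ^+ 2 * leverage U ^+ 2)).
Proof.
move=> e0; apply: le_trans (sum_step_error_le m zeta UU t e0).
rewrite (expectation_sample zeta_gt0 SE
  (G := fun A => cos (theta + dot t (embedding_error U A))) (M := 1) V_gt0).
- under eq_avg do rewrite (embedding_error_mart zeta_gt0 UU).
  rewrite -(sum_var_stepE UU).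
  have := char_mart zeta_gt0 V_gt0 (form_mx U t) theta e0 (leqnn n).
  by rewrite !sum_lt_full.
- exact: (measurable_cos_linear (fun i => t i 0) theta measurable_embedding_error).
- by move=> A; exact: cos_max.
Qed.

(** The sum over the coordinates of the bounds on their second moments. *)
Definition tail_cst : R :=
  \sum_(a < p * p) form_cst (1 *: delta_mx a 0 : 'cV[R]_(p * p)) * p%:R ^+ 2.

Lemma tail_cst_ge0 : 0 <= tail_cst.
Proof.
by apply: sumr_ge0 => a _; rewrite mulr_ge0 ?form_cst_ge0// sqr_ge0.
Qed.

(** Chebyshev's inequality, coordinate by coordinate. *)
Lemma embedding_tail_bound (L : R) : 0 < L ->
  fine (P (outside (fun w => error w) L)) <= tail_cst / L ^+ 2.
Proof.
move=> L0; have mO := measurable_outside measurable_embedding_error L.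
pose G (A : 'M[R]_(m, n)) : R := (`[< exists i, L < `|embedding_error U A i 0| >])%:R.
have GO : (fun w => G (S w)) = \1_(outside (fun w => error w) L).
  apply/funext => w; rewrite indicE /G.
  have [wO|wO] := pselect (outside (fun w => error w) L w).
    by rewrite mem_set// asboolT.
  by rewrite memNset// asboolF.
have -> : fine (P (outside (fun w => error w) L)) = \int[P]_w G (S w).
  by rewrite GO /Rintegral integral_indic// setIT.
rewrite (expectation_sample zeta_gt0 SE (G := G) (M := 1) V_gt0); last 2 first.
- by rewrite GO; exact: measurable_indic.
- by move=> A; rewrite /G; case: asbool; rewrite ?normr1 ?normr0.
apply: (@le_trans _ _ (avg (fun s : {ffun 'I_n -> V} =>
    \sum_a (L ^+ 2)^-1 * embedding_error U (sample_mx s) a 0 ^+ 2))).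
  apply: ler_avg => s; rewrite /G; set x := embedding_error U _.
  have S0 : 0 <= \sum_a (L ^+ 2)^-1 * x a 0 ^+ 2.
    by apply: sumr_ge0 => a _; rewrite mulr_ge0 ?sqr_ge0// invr_ge0 sqr_ge0.
  have [/asboolP[a La]|//] := boolP `[< _ >].
  rewrite (bigD1 a)//= -[leLHS]addr0 lerD//; last first.
    by apply: sumr_ge0 => b _; rewrite mulr_ge0 ?sqr_ge0// invr_ge0 sqr_ge0.
  rewrite mulrC ler_pdivlMr ?exprn_gt0// mul1r -[leRHS]real_normK ?num_real//.
  by rewrite lerXn2r ?nnegrE ?(ltW L0)// ltW.
rewrite avg_sum /tail_cst mulr_suml; apply: ler_sum => a _.
rewrite avgZ mulrC ler_wpM2r ?invr_ge0 ?sqr_ge0//.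
apply: le_trans (sum_var_step_le UU _).
rewrite -sum_lt_full -(avg_mart_sqr zeta_gt0 V_gt0)// le_eqVlt; apply/orP; left.
apply/eqP/eq_avg => s; rewrite -(embedding_error_mart zeta_gt0 UU).
by rewrite dot_delta mul1r.
Qed.

End embedding_bounds.

Section asymptotics.
Context {R : realType}.
Variables (m zeta : nat -> nat).
Hypothesis m_gt0 : \forall n \near \oo, (0 < m n)%N.
Hypothesis zeta_gt0 : \forall n \near \oo, (0 < zeta n)%N.
Variable x : nat -> R.
Hypothesis x_cvg : Num.sqrt (m n)%:R / (zeta n)%:R * x n @[n --> \oo] --> (0 : R).
Hypothesis zeta_cvg : (zeta n)%:R ^+ 2 / (m n)%:R @[n --> \oo] --> (0 : R).
Hypothesis x_ge0 : forall n, 0 <= x n.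

Local Notation y n := (Num.sqrt (m n)%:R / (zeta n)%:R * x n).

Lemma inv_sqrt_cvg0 : (Num.sqrt (m n)%:R)^-1 @[n --> \oo] --> (0 : R).
Proof.
have h : Num.sqrt ((zeta n)%:R ^+ 2 / (m n)%:R) @[n --> \oo] --> (0 : R).
  rewrite -[X in _ --> X](@sqrtr0 R).
  apply: (@cvg_comp _ _ _ _ (@Num.sqrt R) _ _ _ zeta_cvg).
  exact: sqrt_continuous.
apply: (squeeze_cvgr _ (cvg_cst 0) h); near=> n.
have zn : (0 < zeta n)%N by near: n.
rewrite invr_ge0 sqrtr_ge0/= -sqrtrV ?ler0n//; apply: ler_wsqrtr.
rewrite ler_peMl ?invr_ge0 ?ler0n//.
by rewrite expr_ge1 ?ler1n.
Unshelve. all: by end_near. Qed.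

(** Eventually [zeta <= sqrt m]. *)
Lemma x_le : \forall n \near \oo, x n <= y n.
Proof.
have /cvgrPdist_le/(_ _ ltr01) le1 := zeta_cvg.
near=> n.
have mn : (0 < m n)%N by near: n.
have zn : (0 < zeta n)%N by near: n.
have h : (zeta n)%:R ^+ 2 / (m n)%:R <= 1 :> R.
  by apply: le_trans (ler_norm _) _; rewrite -normrN -sub0r; near: n.
have m0 : (0 : R) < (m n)%:R by rewrite ltr0n.
have z0 : (0 : R) < (zeta n)%:R by rewrite ltr0n.
rewrite ler_peMl// ler_pdivlMr// mul1r -[leLHS](ger0_norm (ltW z0)) -sqrtr_sqr.
by apply: ler_wsqrtr; rewrite -[leRHS]mul1r -ler_pdivrMr.
Unshelve. all: by end_near. Qed.

End asymptotics.

Section sketch_limit.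
Context {R : realType}.
Variables (p : nat) (m zeta : nat -> nat).
Variables (d : nat -> measure_display) (T : forall n, measurableType (d n)).
Variables (P : forall n, probability (T n) R) (S : forall n, T n -> 'M[R]_(m n, n)).
Variable U : forall n, 'M[R]_(n, p).
Hypothesis m_gt0 : \forall n \near \oo, (0 < m n)%N.
Hypothesis zeta_gt0 : \forall n \near \oo, (0 < zeta n)%N.
Hypothesis S_embedding : \forall n \near \oo, sparse_sign_embedding (P n) (zeta n) (@S n).
Hypothesis U_orthonormal : \forall n \near \oo, (U n)^T *m U n = 1%:M.
Local Notation y n := (Num.sqrt (m n)%:R / (zeta n)%:R *
  \sum_(i < n) \sum_(j < p) U n i j ^+ 4).
Hypothesis y_cvg : y n @[n --> \oo] --> (0 : R).
Hypothesis zeta_cvg : (zeta n)%:R ^+ 2 / (m n)%:R @[n --> \oo] --> (0 : R).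

Let x_ge0 n : 0 <= \sum_(i < n) \sum_(j < p) U n i j ^+ 4.
Proof.
by apply: sumr_ge0 => i _; apply: sumr_ge0 => j _; rewrite exprn_even_ge0.
Qed.

Let leverage_bound : \forall n \near \oo, leverage (U n) <= p%:R * y n.
Proof.
have := x_le m_gt0 zeta_gt0 zeta_cvg x_ge0; apply: filterS => n xy.
by apply: (le_trans (leverage_le (U n))); rewrite ler_wpM2l.
Qed.

(** This term comes from the fourth powers of the coefficients, and is the reason
   for the scaling in the hypothesis on [U]. *)
Let leverage_scaled n :
  (m n)%:R / (zeta n)%:R ^+ 2 * leverage (U n) ^+ 2 <= p%:R ^+ 2 * y n ^+ 2.
Proof.
have -> : (m n)%:R / (zeta n)%:R ^+ 2 * leverage (U n) ^+ 2 =
    (Num.sqrt (m n)%:R / (zeta n)%:R * leverage (U n)) ^+ 2.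
  by rewrite exprMn expr_div_n sqr_sqrtr.
rewrite -exprMn; set c := Num.sqrt _ / _.
have c0 : 0 <= c by rewrite divr_ge0 ?sqrtr_ge0.
have L0 := leverage_ge0 (U n).
rewrite lerXn2r ?nnegrE ?mulr_ge0// mulrCA.
by apply: ler_wpM2l => //; exact: leverage_le.
Qed.

Lemma sketch_char_cvg (theta : R) (t : 'cV[R]_(p * p)) :
  \int[P n]_w cos (theta + dot t (embedding_error (U n) (@S n w))) @[n --> \oo] -->
  expR (- (coef_norm t / 2 / 2)) * cos theta.
Proof.
set c := form_cst t; have c0 : 0 <= c := form_cst_ge0 t.
pose diag n := \sum_i form_mx (U n) t i i ^+ 2.
pose E n := expR (- ((coef_norm t - diag n) / 2 / 2)) * cos theta.
have E_cvg : E n @[n --> \oo] --> expR (- (coef_norm t / 2 / 2)) * cos theta.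
  apply: cvgM; last exact: cvg_cst.
  rewrite -{2}[coef_norm t]subr0.
  apply: (@cvg_comp _ _ _ _ (@expR R)); last exact: continuous_expR.
  apply: cvgN; do 2 (apply: cvgM; last exact: cvg_cst).
  apply: cvgB; first exact: cvg_cst.
  have h : c * (p%:R * y n) @[n --> \oo] --> (0 : R).
    rewrite [X in _ --> X](_ : 0 = c * (p%:R * 0)); last by rewrite !mulr0.
    apply: cvgM; first exact: cvg_cst.
    by apply: cvgM; first exact: cvg_cst.
  apply: (squeeze_cvgr _ (cvg_cst 0) h); near=> n.
  have /andP[-> /= d1] := diag_form_le (U n) t.
  apply: (le_trans d1); rewrite ler_wpM2l//; near: n; exact: leverage_bound.
suff D : \int[P n]_w cos (theta + dot t (embedding_error (U n) (@S n w))) - E n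
    @[n --> \oo] --> (0 : R).
  have h := cvgD D E_cvg; rewrite add0r in h.
  have EQ : (fun n => \int[P n]_w cos (theta + dot t (embedding_error (U n) (@S n w)))) =
      (fun n => \int[P n]_w cos (theta + dot t (embedding_error (U n) (@S n w))) - E n) + E.
    by apply/funext => n; rewrite fctE subrK.
  by rewrite -EQ in h; exact: h.
apply/cvgrPdist_le => eta eta0.
pose K := c * p%:R ^+ 2; have K0 : 0 <= K by rewrite mulr_ge0// sqr_ge0.
(* The term [e * K] of the error bound does not vanish in the limit: [e] makes
   it at most [eta / 2], and the other terms tend to 0 for this fixed [e]. *)
pose e := eta / (2 * (K + 1)).
have K1 : 0 < K + 1 by rewrite ltr_wpDl.
have e0 : 0 < e by rewrite divr_gt0// mulr_gt0.
pose A1 := 2 * K.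
pose A2 := (c * p%:R) ^+ 2 * p%:R * (1 + (1 + e^-1) * 33).
pose A3 := (1 + e^-1) * 3 * (c ^+ 2 * p%:R ^+ 2).
have r_cvg : A1 * (Num.sqrt (m n)%:R)^-1 + A2 * y n + A3 * (y n * y n)
    @[n --> \oo] --> (0 : R).
  rewrite [X in _ --> X](_ : 0 = A1 * 0 + A2 * 0 + A3 * (0 * 0)); last first.
    by rewrite !mulr0 !addr0.
  have c1 : A1 * (Num.sqrt (m n)%:R)^-1 @[n --> \oo] --> A1 * 0.
    apply: cvgM; first exact: cvg_cst.
    exact: (inv_sqrt_cvg0 zeta_gt0 zeta_cvg).
  have c2 : A2 * y n @[n --> \oo] --> A2 * 0.
    by apply: cvgM; [exact: cvg_cst|exact: y_cvg].
  have c3 : A3 * (y n * y n) @[n --> \oo] --> A3 * (0 * 0).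
    apply: cvgM; first exact: cvg_cst.
    by apply: cvgM; exact: y_cvg.
  by apply: cvgD; [apply: cvgD; [exact: c1|exact: c2]|exact: c3].
have eta2 : 0 < eta / 2 by rewrite divr_gt0.
have /cvgrPdist_le/(_ _ eta2) r_small := r_cvg.
near=> n.
have n0 : (0 < n)%N by near: n; exact: nbhs_infty_gt.
have zn : (0 < zeta n)%N by near: n.
have SE : sparse_sign_embedding (P n) (zeta n) (@S n) by near: n.
have UU : (U n)^T *m U n = 1%:M by near: n.
have lb : leverage (U n) <= p%:R * y n by near: n; exact: leverage_bound.
have rn : A1 * (Num.sqrt (m n)%:R)^-1 + A2 * y n + A3 * (y n * y n) <= eta / 2.
  by apply: le_trans (ler_norm _) _; rewrite -normrN -sub0r; near: n.
rewrite sub0r normrN.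
apply: (le_trans (embedding_char_bound zn n0 SE UU theta t e0)).
have b1 : (c * p%:R) ^+ 2 * leverage (U n) <= (c * p%:R) ^+ 2 * (p%:R * y n).
  by rewrite ler_wpM2l// sqr_ge0.
have b2 : 3 * ((m n)%:R / (zeta n)%:R ^+ 2) * (c ^+ 2 * leverage (U n) ^+ 2) <=
    3 * (c ^+ 2 * (p%:R ^+ 2 * y n ^+ 2)).
  by rewrite -mulrA ler_wpM2l// mulrCA ler_wpM2l ?sqr_ge0.
have e1 : 0 <= 1 + e^-1 by rewrite addr_ge0// invr_ge0 ltW.
have eK : e * K <= eta / 2.
  have -> : e * K = eta / 2 * (K / (K + 1)) by rewrite /e; field; rewrite gt_eqF.
  by rewrite ler_piMr ?(ltW eta2)// ler_pdivrMr// mul1r lerDl.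
rewrite -/c -/K.
apply: (@le_trans _ _ (A1 * (Num.sqrt (m n)%:R)^-1 + A2 * y n + A3 * (y n * y n) + eta / 2)).
  have -> : A2 * y n = (c * p%:R) ^+ 2 * (p%:R * y n) +
      (1 + e^-1) * (33 * ((c * p%:R) ^+ 2 * (p%:R * y n))) by rewrite /A2; ring.
  have -> : A3 * (y n * y n) = (1 + e^-1) * (3 * (c ^+ 2 * (p%:R ^+ 2 * y n ^+ 2))).
    by rewrite /A3; ring.
  have b3 : (1 + e^-1) * (33 * ((c * p%:R) ^+ 2 * leverage (U n)) +
      3 * ((m n)%:R / (zeta n)%:R ^+ 2) * (c ^+ 2 * leverage (U n) ^+ 2)) <=
      (1 + e^-1) * (33 * ((c * p%:R) ^+ 2 * (p%:R * y n)) +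
      3 * (c ^+ 2 * (p%:R ^+ 2 * y n ^+ 2))).
    by apply: ler_wpM2l => //; apply: lerD => //; rewrite ler_wpM2l.
  apply: (le_trans (lerD (lerD (lerD (lexx _) b1) eK) b3)).
  by rewrite le_eqVlt; apply/orP; left; apply/eqP; rewrite /A1; ring.
by rewrite [leRHS]splitr lerD2r.
Unshelve. all: by end_near. Qed.

Lemma sketch_tight (e : R) : 0 < e -> exists2 L0 : R, 0 < L0 &
  \forall n \near \oo, forall L, L0 <= L ->
    fine (P n (outside (fun w => embedding_error (U n) (@S n w)) L)) <= e.
Proof.
move=> e0; pose C : R := tail_cst p; have C0 : 0 <= C := tail_cst_ge0 p.
exists (Num.sqrt (C / e) + 1); first by rewrite ltr_wpDl ?sqrtr_ge0.
near=> n => L CL.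
have n0 : (0 < n)%N by near: n; exact: nbhs_infty_gt.
have zn : (0 < zeta n)%N by near: n.
have SE : sparse_sign_embedding (P n) (zeta n) (@S n) by near: n.
have UU : (U n)^T *m U n = 1%:M by near: n.
have s0 : 0 <= Num.sqrt (C / e) by exact: sqrtr_ge0.
have L0 : 0 < L by lra.
apply: (le_trans (embedding_tail_bound zn n0 SE UU L0)).
rewrite ler_pdivrMr ?exprn_gt0// [leRHS]mulrC -ler_pdivrMr//.
rewrite -[leLHS]sqr_sqrtr ?divr_ge0 ?(ltW e0)//.
by rewrite lerXn2r ?nnegrE ?(ltW L0)//; lra.
Unshelve. all: by end_near. Qed.

End sketch_limit.


Theorem mainTheorem12 (R : realType) (p : nat)
    (m : nat -> nat) (zeta : nat -> nat)
    (hm : m n @[n --> \oo] --> \oo)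
    (hmn : \forall n \near \oo, (m n < n)%N)
    (hzeta : forall k : nat, (0 < k)%N -> (0 < zeta k <= k)%N)
    (d : nat -> measure_display) (T : forall n, measurableType (d n))
    (P : forall n, probability (T n) R)
    (S : forall n, T n -> 'M[R]_(m n, n))
    (hS : \forall n \near \oo, sparse_sign_embedding (P n) (zeta (m n)) (S n))
    (U : forall n, 'M[R]_(n, p))
    (hU : \forall n \near \oo, (U n)^T *m U n = 1%:M)
    (hU4 : Num.sqrt (m n)%:R / (zeta (m n))%:R
             * \sum_(i < n) \sum_(j < p) U n i j ^+ 4 @[n --> \oo] --> (0 : R))
    (hzeta2 : (zeta (m n))%:R ^+ 2 / (m n)%:R @[n --> \oo] --> (0 : R)) :
  cvg_to_normal P
    (fun n w => Num.sqrt (m n)%:R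
       *: vec ((U n)^T *m (S n w)^T *m S n w *m U n - 1%:M))
    0 (1%:M + commutation_mx R p).
Proof.
have m_gt0 : \forall n \near \oo, (0 < m n)%N := hm _ (nbhs_infty_gt 0%N).
have zeta_gt0 : \forall n \near \oo, (0 < zeta (m n))%N.
  by apply: filterS m_gt0 => n /hzeta/andP[].
exists (p * p)%N, (covariance_root p); split; first exact: covariance_rootE.
pose X n w := embedding_error (U n) (S n w).
change (cvg_in_distribution P X (std_normal R (p * p))
  (gaussian_vector 0 (covariance_root p))).
apply: levy_continuity.
- near=> n => a; apply: (@measurable_embedding_error _ _ _ _ (zeta (m n)) _ _ (P n)).
  by near: n.
- exact: measurable_gaussian_vector.
- move=> theta t; rewrite gaussian_vector_char.
  exact: (sketch_char_cvg m_gt0 zeta_gt0 hS hU hU4 hzeta2).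
- exact: (sketch_tight zeta_gt0 hS hU).
Unshelve. all: by end_near. Qed.
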